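(* Let $\Bbbk$ be a field and $\mathcal C$ a $\Bbbk$-linear monoidal category. The pseudofunctor $\mathbb P:\mathcal C\text{-Mod}\to\mathcal C\text{-Tamb}$, which is the identity on objects and sends a $\mathcal C$-module functor $\Phi:\mathbf M\to\mathbf N$ to the Tambara module $\langle -,\Phi-\rangle:\mathbf M\nrightarrow\mathbf N$, is a map equipment. Moreover, a Tambara module $\mathtt\Phi:\mathbf M\nrightarrow\mathbf N$ between Cauchy complete $\mathcal C$-module categories has a right adjoint in $\mathcal C\text{-Tamb}$ if and only if it is representable, i.e. isomorphic in $\mathcal C\text{-Tamb}$ to $\mathbb P(\Phi)$ for some $\mathcal C$-module functor $\Phi:\mathbf M\to\mathbf N$.
   Context: All categories, functors, transformations, monoidal categories and bicategories are $\Bbbk$-linear; $FG$ abbreviates $F\otimes G$ in $\mathcal C$; $\langle X,Y\rangle$ denotes a Hom-space. Module categories. A $\mathcal C$-module category is a category $\mathbf M$ with a strong monoidal functor $\mathcal C\to\mathrm{End}(\mathbf M)$, $F\mapsto\mathbf MF$, with coherence isomorphisms $\mathbf m_{G,F}:\mathbf MG\,\mathbf MF\Rightarrow\mathbf M(GF)$ and $\mathbf m_{\mathbb 1}:\mathrm{Id}_{\mathbf M}\Rightarrow\mathbf M\mathbb 1$. A $\mathcal C$-module functor $\Phi:\mathbf M\to\mathbf N$ is a functor with natural isomorphisms $\phi_F:\mathbf NF\,\Phi\Rightarrow\Phi\,\mathbf MF$ (natural in $F\in\mathcal C$) satisfying the usual coherence axioms; a $\mathcal C$-module transformation is a natural transformation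 compatible with these isomorphisms. They form the bicategory $\mathcal C\text{-Mod}$. Tambara modules. A profunctor $\mathbf M\nrightarrow\mathbf N$ is a functor $\mathbf N^{\mathrm{op}}\otimes_\Bbbk\mathbf M\to\mathbf{Vec}_\Bbbk$; composition is $(\mathtt\Psi\diamond\mathtt\Phi)(C,A)=\int^B\mathtt\Psi(C,B)\otimes_\Bbbk\mathtt\Phi(B,A)$. A Tambara module $\mathtt\Phi:\mathbf M\nrightarrow\mathbf N$ is a profunctor with linear maps $\mathsf t_{H;Y,X}:\mathtt\Phi(Y,X)\to\mathtt\Phi(\mathbf NH\,Y,\mathbf MH\,X)$, natural in $Y,X$, extranatural in $H\in\mathcal C$, such that $\mathtt\Phi((\mathbf n_{G,F})_Y,\mathrm{id})\circ\mathsf t_{GF;Y,X}=\mathtt\Phi(\mathrm{id},(\mathbf m_{G,F})_X)\circ\mathsf t_{G;\mathbf NFY,\mathbf MFX}\circ\mathsf t_{F;Y,X}$ and $\mathtt\Phi((\mathbf n_{\mathbb 1})_Y,(\mathbf m_{\mathbb 1})_X^{-1})\circ\mathsf t_{\mathbb 1;Y,X}=\mathrm{id}$. A Tambara morphism is a morphism of profunctors commuting with the maps $\mathsf t$. Composites $\mathtt\Psi\diamond\mathtt\Phi$ carry the Tambara structure induced by $\mathsf t^{\mathtt\Psi}\otimes\mathsf t^{\mathtt\Phi}$. The resulting bicategory of $\mathcal C$-module categories, Tambara modules and Tambara morphisms is $\mathcal C\text{-Tamb}$; the identity on $\mathbf M$ is the Hom-profunctor with Tambara structure $f\mapsto\mathbf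 MH(f)$. The pseudofunctor $\mathbb P$. $\mathbb P$ is the identity on objects; $\mathbb P(\Phi)=\langle-,\Phi-\rangle$ is the profunctor $(Z,X)\mapsto\mathrm{Hom}_{\mathbf N}(Z,\Phi X)$ with Tambara structure $f\mapsto(\phi_F)_X\circ\mathbf NF(f)$; a module transformation $d:\Phi\Rightarrow\Phi'$ is sent to postcomposition with the components of $d$; the coherence isomorphisms $\mathbb P(\Phi)\diamond\mathbb P(\Omega)\cong\mathbb P(\Phi\circ\Omega)$ come from the Yoneda lemma. A map equipment is a pseudofunctor that is the identity on objects, is locally full and faithful, and sends every 1-morphism to a 1-morphism admitting a right adjoint in the target. A $\Bbbk$-linear category is Cauchy complete if and only if it is additive and idempotent split. *)

(* Defs.v *)
From HB Require Import structures.
From mathcomp Require Import all_boot all_algebra.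
From mathcomp Require Import boolp.

Set Implicit Arguments.
Unset Strict Implicit.
Unset Printing Implicit Defensive.

Import GRing.Theory.
Local Open Scope ring_scope.
Local Open Scope quotient_scope.

Declare Scope cat_scope.
Delimit Scope cat_scope with cat.

(* Linear categories are small: objects form a Type and the Hom-spaces are     *)
(* (arbitrary, possibly infinite-dimensional) K-vector spaces.  Equality of    *)
(* morphisms is Leibniz equality.  "linear" is the MathComp predicate          *)
(* f (a *: u + v) = a *: f u + f v.                                            *)

Record lincat (K : fieldType) : Type := LinCat {
  ob :> Type;
  hom : ob -> ob -> lmodType K;
  idm : forall x, hom x x;
  comp : forall x y z, hom y z -> hom x y -> hom x z;
  comp_linl : forall x y z (f : hom x y), linear (fun g : hom y z => comp g f);
  comp_linr : forall x y z (g : hom y z), linear (fun f : hom x y => comp g f);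
  compA : forall w x y z (h : hom y z) (g : hom x y) (f : hom w x),
    comp h (comp g f) = comp (comp h g) f;
  comp1m : forall x y (f : hom x y), comp (idm y) f = f;
  compm1 : forall x y (f : hom x y), comp f (idm x) = f }.

Arguments hom {K l}.
Arguments idm {K l}.
Arguments comp {K l x y z}.

Notation "g ∘ f" := (comp g f) (at level 40, left associativity) : cat_scope.
Local Open Scope cat_scope.

Definition inverses (K : fieldType) (C : lincat K) (x y : C)
    (f : hom x y) (g : hom y x) : Prop :=
  g ∘ f = idm x /\ f ∘ g = idm y.

Definition is_iso (K : fieldType) (C : lincat K) (x y : C) (f : hom x y) : Prop :=
  exists g : hom y x, inverses f g.

Definition zero_object (K : fieldType) (C : lincat K) (z : C) : Prop :=
  forall x, (forall f : hom x z, f = 0) /\ (forall f : hom z x, f = 0).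

Definition biproduct (K : fieldType) (C : lincat K) (x y s : C) : Prop :=
  exists (i1 : hom x s) (i2 : hom y s) (p1 : hom s x) (p2 : hom s y),
    [/\ p1 ∘ i1 = idm x, p2 ∘ i2 = idm y, p1 ∘ i2 = 0, p2 ∘ i1 = 0
      & i1 ∘ p1 + i2 ∘ p2 = idm s].

Definition additive_cat (K : fieldType) (C : lincat K) : Prop :=
  (exists z : C, zero_object z) /\
  (forall x y : C, exists s : C, biproduct x y s).

Definition idempotent_split (K : fieldType) (C : lincat K) : Prop :=
  forall (x : C) (e : hom x x), e ∘ e = e ->
    exists (y : C) (r : hom x y) (s : hom y x), r ∘ s = idm y /\ s ∘ r = e.

(* For categories enriched in vector spaces, Cauchy completeness (existence of *)
(* all absolute weighted colimits) amounts to the following condition.         *)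
Definition cauchy_complete (K : fieldType) (C : lincat K) : Prop :=
  additive_cat C /\ idempotent_split C.

Record linfunctor (K : fieldType) (C D : lincat K) : Type := LinFunctor {
  fob :> C -> D;
  fmap : forall x y, hom x y -> hom (fob x) (fob y);
  fmap_lin : forall x y, linear (@fmap x y);
  fmap_id : forall x, fmap (idm x) = idm (fob x);
  fmap_comp : forall x y z (g : hom y z) (f : hom x y),
    fmap (g ∘ f) = fmap g ∘ fmap f }.

Arguments fmap {K C D} l {x y}.

Record moncat (K : fieldType) : Type := MonCat {
  mon_cat :> lincat K;
  tens : mon_cat -> mon_cat -> mon_cat;
  tensm : forall x x' y y' : mon_cat,
    hom x x' -> hom y y' -> hom (tens x y) (tens x' y');
  tensm_linl : forall (x x' y y' : mon_cat) (g : hom y y'),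
    linear (fun f : hom x x' => tensm f g);
  tensm_linr : forall (x x' y y' : mon_cat) (f : hom x x'),
    linear (fun g : hom y y' => tensm f g);
  tensm_id : forall x y : mon_cat, tensm (idm x) (idm y) = idm (tens x y);
  tensm_comp : forall (x x' x'' y y' y'' : mon_cat)
      (f' : hom x' x'') (f : hom x x') (g' : hom y' y'') (g : hom y y'),
    tensm (f' ∘ f) (g' ∘ g) = tensm f' g' ∘ tensm f g;
  mon1 : mon_cat;
  mon_assoc : forall x y z, hom (tens (tens x y) z) (tens x (tens y z));
  mon_lunit : forall x, hom (tens mon1 x) x;
  mon_runit : forall x, hom (tens x mon1) x;
  mon_assoc_iso : forall x y z, is_iso (mon_assoc x y z);
  mon_lunit_iso : forall x, is_iso (mon_lunit x);
  mon_runit_iso : forall x, is_iso (mon_runit x);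
  mon_assoc_nat : forall (x x' y y' z z' : mon_cat)
      (f : hom x x') (g : hom y y') (h : hom z z'),
    mon_assoc x' y' z' ∘ tensm (tensm f g) h
    = tensm f (tensm g h) ∘ mon_assoc x y z;
  mon_lunit_nat : forall (x x' : mon_cat) (f : hom x x'),
    mon_lunit x' ∘ tensm (idm mon1) f = f ∘ mon_lunit x;
  mon_runit_nat : forall (x x' : mon_cat) (f : hom x x'),
    mon_runit x' ∘ tensm f (idm mon1) = f ∘ mon_runit x;
  mon_pentagon : forall w x y z,
    mon_assoc w x (tens y z) ∘ mon_assoc (tens w x) y z
    = tensm (idm w) (mon_assoc x y z) ∘ mon_assoc w (tens x y) z
      ∘ tensm (mon_assoc w x y) (idm z);
  mon_triangle : forall x y,
    tensm (idm x) (mon_lunit y) ∘ mon_assoc x mon1 y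
    = tensm (mon_runit x) (idm y) }.

Arguments tensm {K m x x' y y'}.
Arguments mon1 {K m}.
Arguments mon_assoc {K m}.
Arguments mon_lunit {K m}.
Arguments mon_runit {K m}.

(* A C-module category is a linear category M with a strong monoidal linear    *)
(* functor from C to the strict monoidal category End(M), written out in       *)
(* components: act F is the endofunctor MF, actm f X the component at X of the *)
(* natural transformation Mf, actM G F X that of m_{G,F}, act1 X that of the   *)
(* unit constraint, and act1V its inverse.                                     *)
Record modcat (K : fieldType) (C : moncat K) : Type := ModCat {
  mod_cat :> lincat K;
  act : C -> linfunctor mod_cat mod_cat;
  actm : forall F G : C, hom F G -> forall X, hom (act F X) (act G X);
  actm_nat : forall (F G : C) (h : hom F G) (X Y : mod_cat) (f : hom X Y),
    actm h Y ∘ fmap (act F) f = fmap (act G) f ∘ actm h X;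
  actm_lin : forall (F G : C) X, linear (fun h : hom F G => actm h X);
  actm_id : forall (F : C) X, actm (idm F) X = idm (act F X);
  actm_comp : forall (F G H : C) (g : hom G H) (f : hom F G) X,
    actm (g ∘ f) X = actm g X ∘ actm f X;
  actM : forall G F X, hom (act G (act F X)) (act (tens G F) X);
  actM_iso : forall G F X, is_iso (actM G F X);
  actM_nat : forall G F (X Y : mod_cat) (f : hom X Y),
    actM G F Y ∘ fmap (act G) (fmap (act F) f)
    = fmap (act (tens G F)) f ∘ actM G F X;
  actM_natl : forall (G G' F F' : C) (g : hom G G') (f : hom F F') X,
    actM G' F' X ∘ (actm g (act F' X) ∘ fmap (act G) (actm f X))
    = actm (tensm g f) X ∘ actM G F X;
  act1 : forall X, hom X (act mon1 X);
  act1V : forall X, hom (act mon1 X) X;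
  act1_inv : forall X, inverses (act1 X) (act1V X);
  act1_nat : forall (X Y : mod_cat) (f : hom X Y),
    act1 Y ∘ f = fmap (act mon1) f ∘ act1 X;
  act_assoc : forall H G F X,
    actm (mon_assoc H G F) X ∘ (actM (tens H G) F X ∘ actM H G (act F X))
    = actM H (tens G F) X ∘ fmap (act H) (actM G F X);
  act_lunit : forall F X,
    actm (mon_lunit F) X ∘ (actM mon1 F X ∘ act1 (act F X)) = idm (act F X);
  act_runit : forall F X,
    actm (mon_runit F) X ∘ (actM F mon1 X ∘ fmap (act F) (act1 X))
    = idm (act F X) }.

Arguments act {K C} m F : rename.
Arguments actm {K C m F G} h X : rename.
Arguments actM {K C m} G F X : rename.
Arguments act1 {K C m} X : rename.
Arguments act1V {K C m} X : rename.

Record modfun (K : fieldType) (C : moncat K) (M N : modcat C) : Type := ModFun {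
  mf_fun :> linfunctor M N;
  mf_str : forall (F : C) X, hom (act N F (mf_fun X)) (mf_fun (act M F X));
  mf_iso : forall F X, is_iso (mf_str F X);
  mf_nat : forall F (X Y : M) (f : hom X Y),
    mf_str F Y ∘ fmap (act N F) (fmap mf_fun f)
    = fmap mf_fun (fmap (act M F) f) ∘ mf_str F X;
  mf_natl : forall (F G : C) (h : hom F G) X,
    mf_str G X ∘ actm h (mf_fun X) = fmap mf_fun (actm h X) ∘ mf_str F X;
  mf_mul : forall G F X,
    mf_str (tens G F) X ∘ actM G F (mf_fun X)
    = fmap mf_fun (actM G F X) ∘ (mf_str G (act M F X)
      ∘ fmap (act N G) (mf_str F X));
  mf_unit : forall X, mf_str mon1 X ∘ act1 (mf_fun X) = fmap mf_fun (act1 X) }.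

Arguments mf_str {K C M N} m F X : rename.

Record modtrans (K : fieldType) (C : moncat K) (M N : modcat C)
    (Phi Psi : modfun M N) : Type := ModTrans {
  mt :> forall X, hom (Phi X) (Psi X);
  mt_nat : forall (X Y : M) (f : hom X Y), mt Y ∘ fmap Phi f = fmap Psi f ∘ mt X;
  mt_str : forall F X,
    mt (act M F X) ∘ mf_str Phi F X = mf_str Psi F X ∘ fmap (act N F) (mt X) }.

(* A Tambara module P : M -/-> N.  Its underlying profunctor, i.e. a linear    *)
(* functor from the tensor product of N^op and M to vector spaces, is given by *)
(* the spaces pob Y X and the bilinear action pmap f g of Hom_N and Hom_M.     *)
Record tambara (K : fieldType) (C : moncat K) (M N : modcat C) : Type := Tambara {
  pob : N -> M -> lmodType K;
  pmap : forall Y Y' X X', hom Y' Y -> hom X X' -> pob Y X -> pob Y' X';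
  pmap_lin : forall Y Y' X X' (f : hom Y' Y) (g : hom X X'), linear (pmap f g);
  pmap_linl : forall Y Y' X X' (g : hom X X') (p : pob Y X),
    linear (fun f : hom Y' Y => pmap f g p);
  pmap_linr : forall Y Y' X X' (f : hom Y' Y) (p : pob Y X),
    linear (fun g : hom X X' => pmap f g p);
  pmap_id : forall Y X (p : pob Y X), pmap (idm Y) (idm X) p = p;
  pmap_comp : forall Y Y' Y'' X X' X'' (f' : hom Y'' Y') (f : hom Y' Y)
      (g' : hom X' X'') (g : hom X X') (p : pob Y X),
    pmap (f ∘ f') (g' ∘ g) p = pmap f' g' (pmap f g p);
  tstr : forall (H : C) Y X, pob Y X -> pob (act N H Y) (act M H X);
  tstr_lin : forall H Y X, linear (@tstr H Y X);
  tstr_nat : forall H Y Y' X X' (f : hom Y' Y) (g : hom X X') (p : pob Y X),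
    tstr H (pmap f g p) = pmap (fmap (act N H) f) (fmap (act M H) g) (tstr H p);
  tstr_extranat : forall (H H' : C) (h : hom H H') Y X (p : pob Y X),
    pmap (idm (act N H Y)) (actm h X) (tstr H p)
    = pmap (actm h Y) (idm (act M H' X)) (tstr H' p);
  tstr_mul : forall G F Y X (p : pob Y X),
    pmap (actM G F Y) (idm (act M (tens G F) X)) (tstr (tens G F) p)
    = pmap (idm (act N G (act N F Y))) (actM G F X) (tstr G (tstr F p));
  tstr_unit : forall Y X (p : pob Y X),
    pmap (act1 Y) (act1V X) (tstr mon1 p) = p }.

Arguments pob {K C M N}.
Arguments pmap {K C M N} t {Y Y' X X'}.
Arguments tstr {K C M N} t H {Y X}.

Record tambmor (K : fieldType) (C : moncat K) (M N : modcat C)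
    (P Q : tambara M N) : Type := TambMor {
  tm :> forall Y X, pob P Y X -> pob Q Y X;
  tm_lin : forall Y X, linear (@tm Y X);
  tm_nat : forall Y Y' X X' (f : hom Y' Y) (g : hom X X') (p : pob P Y X),
    tm (pmap P f g p) = pmap Q f g (tm p);
  tm_str : forall H Y X (p : pob P Y X), tm (tstr P H p) = tstr Q H (tm p) }.

Arguments tm {K C M N P Q} t {Y X} : rename.

(* A linear bicategory with given collection of objects.                       *)
Record bicategory (K : fieldType) (O : Type) : Type := Bicategory {
  hom1 : O -> O -> Type;
  hom2 : forall a b, hom1 a b -> hom1 a b -> lmodType K;
  id2 : forall a b (f : hom1 a b), hom2 f f;
  vcomp : forall a b (f g h : hom1 a b), hom2 g h -> hom2 f g -> hom2 f h;
  id1 : forall a, hom1 a a;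
  comp1 : forall a b c, hom1 b c -> hom1 a b -> hom1 a c;
  hcomp : forall a b c (g g' : hom1 b c) (f f' : hom1 a b),
    hom2 g g' -> hom2 f f' -> hom2 (comp1 g f) (comp1 g' f');
  assoc : forall a b c d (h : hom1 c d) (g : hom1 b c) (f : hom1 a b),
    hom2 (comp1 (comp1 h g) f) (comp1 h (comp1 g f));
  assocV : forall a b c d (h : hom1 c d) (g : hom1 b c) (f : hom1 a b),
    hom2 (comp1 h (comp1 g f)) (comp1 (comp1 h g) f);
  lunit : forall a b (f : hom1 a b), hom2 (comp1 (id1 b) f) f;
  lunitV : forall a b (f : hom1 a b), hom2 f (comp1 (id1 b) f);
  runit : forall a b (f : hom1 a b), hom2 (comp1 f (id1 a)) f;
  runitV : forall a b (f : hom1 a b), hom2 f (comp1 f (id1 a));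
  vcomp_linl : forall a b (f g h : hom1 a b) (x : hom2 f g),
    linear (fun y : hom2 g h => vcomp y x);
  vcomp_linr : forall a b (f g h : hom1 a b) (y : hom2 g h),
    linear (fun x : hom2 f g => vcomp y x);
  vcompA : forall a b (f g h k : hom1 a b)
      (z : hom2 h k) (y : hom2 g h) (x : hom2 f g),
    vcomp z (vcomp y x) = vcomp (vcomp z y) x;
  vcomp1l : forall a b (f g : hom1 a b) (x : hom2 f g), vcomp (id2 g) x = x;
  vcomp1r : forall a b (f g : hom1 a b) (x : hom2 f g), vcomp x (id2 f) = x;
  hcomp_linl : forall a b c (g g' : hom1 b c) (f f' : hom1 a b) (x : hom2 f f'),
    linear (fun y : hom2 g g' => hcomp y x);
  hcomp_linr : forall a b c (g g' : hom1 b c) (f f' : hom1 a b) (y : hom2 g g'),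
    linear (fun x : hom2 f f' => hcomp y x);
  hcomp_id : forall a b c (g : hom1 b c) (f : hom1 a b),
    hcomp (id2 g) (id2 f) = id2 (comp1 g f);
  interchange : forall a b c (g g' g'' : hom1 b c) (f f' f'' : hom1 a b)
      (y' : hom2 g' g'') (y : hom2 g g') (x' : hom2 f' f'') (x : hom2 f f'),
    hcomp (vcomp y' y) (vcomp x' x) = vcomp (hcomp y' x') (hcomp y x);
  assocK : forall a b c d (h : hom1 c d) (g : hom1 b c) (f : hom1 a b),
    vcomp (assocV h g f) (assoc h g f) = id2 _;
  assocVK : forall a b c d (h : hom1 c d) (g : hom1 b c) (f : hom1 a b),
    vcomp (assoc h g f) (assocV h g f) = id2 _;
  lunitK : forall a b (f : hom1 a b), vcomp (lunitV f) (lunit f) = id2 _;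
  lunitVK : forall a b (f : hom1 a b), vcomp (lunit f) (lunitV f) = id2 _;
  runitK : forall a b (f : hom1 a b), vcomp (runitV f) (runit f) = id2 _;
  runitVK : forall a b (f : hom1 a b), vcomp (runit f) (runitV f) = id2 _;
  assoc_nat : forall a b c d (h h' : hom1 c d) (g g' : hom1 b c) (f f' : hom1 a b)
      (z : hom2 h h') (y : hom2 g g') (x : hom2 f f'),
    vcomp (assoc h' g' f') (hcomp (hcomp z y) x)
    = vcomp (hcomp z (hcomp y x)) (assoc h g f);
  lunit_nat : forall a b (f f' : hom1 a b) (x : hom2 f f'),
    vcomp (lunit f') (hcomp (id2 (id1 b)) x) = vcomp x (lunit f);
  runit_nat : forall a b (f f' : hom1 a b) (x : hom2 f f'),
    vcomp (runit f') (hcomp x (id2 (id1 a))) = vcomp x (runit f);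
  pentagon : forall a b c d e
      (k : hom1 d e) (h : hom1 c d) (g : hom1 b c) (f : hom1 a b),
    vcomp (assoc k h (comp1 g f)) (assoc (comp1 k h) g f)
    = vcomp (hcomp (id2 k) (assoc h g f))
        (vcomp (assoc k (comp1 h g) f) (hcomp (assoc k h g) (id2 f)));
  triangle : forall a b c (g : hom1 b c) (f : hom1 a b),
    vcomp (hcomp (id2 g) (lunit f)) (assoc g (id1 b) f)
    = hcomp (runit g) (id2 f) }.

Arguments hom1 {K O}.
Arguments hom2 {K O} b {a b} : rename.
Arguments id2 {K O} b {a b} : rename.
Arguments vcomp {K O} b {a b f g h} : rename.
Arguments id1 {K O}.
Arguments comp1 {K O} b {a b c} : rename.
Arguments hcomp {K O} b {a b c g g' f f'} : rename.
Arguments assoc {K O} b {a b c d} : rename.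
Arguments assocV {K O} b {a b c d} : rename.
Arguments lunit {K O} b {a b} : rename.
Arguments lunitV {K O} b {a b} : rename.
Arguments runit {K O} b {a b} : rename.
Arguments runitV {K O} b {a b} : rename.

Definition inverse2 (K : fieldType) (O : Type) (B : bicategory K O) (a b : O)
    (f g : hom1 B a b) (x : hom2 B f g) (y : hom2 B g f) : Prop :=
  vcomp B y x = id2 B f /\ vcomp B x y = id2 B g.

Definition is_iso2 (K : fieldType) (O : Type) (B : bicategory K O) (a b : O)
    (f g : hom1 B a b) (x : hom2 B f g) : Prop :=
  exists y : hom2 B g f, inverse2 x y.

Definition isomorphic1 (K : fieldType) (O : Type) (B : bicategory K O) (a b : O)
    (f g : hom1 B a b) : Prop :=
  exists x : hom2 B f g, is_iso2 x.

Definition is_adjunction (K : fieldType) (O : Type) (B : bicategory K O) (a b : O)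
    (f : hom1 B a b) (g : hom1 B b a)
    (eta : hom2 B (id1 B a) (comp1 B g f))
    (eps : hom2 B (comp1 B f g) (id1 B b)) : Prop :=
  vcomp B (lunit B f) (vcomp B (hcomp B eps (id2 B f)) (vcomp B (assocV B f g f)
    (vcomp B (hcomp B (id2 B f) eta) (runitV B f)))) = id2 B f /\
  vcomp B (runit B g) (vcomp B (hcomp B (id2 B g) eps) (vcomp B (assoc B g f g)
    (vcomp B (hcomp B eta (id2 B g)) (lunitV B g)))) = id2 B g.

Definition has_right_adjoint (K : fieldType) (O : Type) (B : bicategory K O)
    (a b : O) (f : hom1 B a b) : Prop :=
  exists (g : hom1 B b a) (eta : hom2 B (id1 B a) (comp1 B g f))
         (eps : hom2 B (comp1 B f g) (id1 B b)), is_adjunction eta eps.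

Record pseudofunctor (K : fieldType) (O O' : Type)
    (B : bicategory K O) (B' : bicategory K O') : Type := PseudoFunctor {
  ps0 :> O -> O';
  ps1 : forall a b, hom1 B a b -> hom1 B' (ps0 a) (ps0 b);
  ps2 : forall a b (f g : hom1 B a b), hom2 B f g -> hom2 B' (ps1 f) (ps1 g);
  psM : forall a b c (g : hom1 B b c) (f : hom1 B a b),
    hom2 B' (comp1 B' (ps1 g) (ps1 f)) (ps1 (comp1 B g f));
  psU : forall a, hom2 B' (id1 B' (ps0 a)) (ps1 (id1 B a));
  ps2_lin : forall a b (f g : hom1 B a b), linear (@ps2 a b f g);
  ps2_id : forall a b (f : hom1 B a b), ps2 (id2 B f) = id2 B' (ps1 f);
  ps2_comp : forall a b (f g h : hom1 B a b) (y : hom2 B g h) (x : hom2 B f g),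
    ps2 (vcomp B y x) = vcomp B' (ps2 y) (ps2 x);
  psM_iso : forall a b c (g : hom1 B b c) (f : hom1 B a b), is_iso2 (psM g f);
  psU_iso : forall a, is_iso2 (psU a);
  psM_nat : forall a b c (g g' : hom1 B b c) (f f' : hom1 B a b)
      (y : hom2 B g g') (x : hom2 B f f'),
    vcomp B' (psM g' f') (hcomp B' (ps2 y) (ps2 x))
    = vcomp B' (ps2 (hcomp B y x)) (psM g f);
  psM_assoc : forall a b c d (h : hom1 B c d) (g : hom1 B b c) (f : hom1 B a b),
    vcomp B' (ps2 (assoc B h g f))
      (vcomp B' (psM (comp1 B h g) f) (hcomp B' (psM h g) (id2 B' (ps1 f))))
    = vcomp B' (psM h (comp1 B g f))
      (vcomp B' (hcomp B' (id2 B' (ps1 h)) (psM g f))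
                (assoc B' (ps1 h) (ps1 g) (ps1 f)));
  psM_lunit : forall a b (f : hom1 B a b),
    vcomp B' (ps2 (lunit B f))
      (vcomp B' (psM (id1 B b) f) (hcomp B' (psU b) (id2 B' (ps1 f))))
    = lunit B' (ps1 f);
  psM_runit : forall a b (f : hom1 B a b),
    vcomp B' (ps2 (runit B f))
      (vcomp B' (psM f (id1 B a)) (hcomp B' (id2 B' (ps1 f)) (psU a)))
    = runit B' (ps1 f) }.

Arguments ps1 {K O O' B B'} p {a b} : rename.
Arguments ps2 {K O O' B B'} p {a b f g} : rename.

Definition locally_fully_faithful (K : fieldType) (O O' : Type)
    (B : bicategory K O) (B' : bicategory K O') (F : pseudofunctor B B') : Prop :=
  forall (a b : O) (f g : hom1 B a b),
    injective (fun x : hom2 B f g => ps2 F x) /\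
    (forall y : hom2 B' (ps1 F f) (ps1 F g), exists x : hom2 B f g, ps2 F x = y).

Definition map_equipment (K : fieldType) (O : Type)
    (B B' : bicategory K O) (F : pseudofunctor B B') : Prop :=
  [/\ forall a : O, F a = a,
      locally_fully_faithful F
    & forall (a b : O) (f : hom1 B a b), has_right_adjoint (ps1 F f)].

Section LinearMaps.
Variables (K : fieldType) (U V : lmodType K) (f : U -> V).
Hypothesis fl : linear f.

Lemma lin0 : f 0 = 0.
Proof. by have := fl (-1) 0 0; rewrite scaleN1r oppr0 addr0 scaleN1r addNr. Qed.
Lemma linD u v : f (u + v) = f u + f v.
Proof. by have := fl 1 u v; rewrite !scale1r. Qed.
Lemma linZ a u : f (a *: u) = a *: f u.
Proof. by have := fl a u 0; rewrite lin0 !addr0. Qed.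
Lemma linN u : f (- u) = - f u.
Proof. by rewrite -!scaleN1r linZ. Qed.
Lemma lin_sum I (r : seq I) (F : I -> U) :
  f (\sum_(i <- r) F i) = \sum_(i <- r) f (F i).
Proof.
elim: r => [|i r IH]; first by rewrite !big_nil lin0.
by rewrite !big_cons linD IH.
Qed.
End LinearMaps.

Lemma lin_id (K : fieldType) (U : lmodType K) : linear (fun u : U => u).
Proof. by []. Qed.

Lemma lin_comp (K : fieldType) (U V W : lmodType K) (g : V -> W) (f : U -> V) :
  linear g -> linear f -> linear (fun u => g (f u)).
Proof. by move=> gl fl a u v; rewrite fl gl. Qed.

Lemma lin_comb (K : fieldType) (U V : lmodType K) (a : K) (f g : U -> V) :
  linear f -> linear g -> linear (fun u => a *: f u + g u).
Proof.
move=> fl gl b p q /=; rewrite fl gl !scalerDr !scalerA mulrC.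
by rewrite -!addrA; congr (_ + _); rewrite !addrA; congr (_ + _); exact: addrC.
Qed.

Section ModTransModule.
Variables (K : fieldType) (C : moncat K) (M N : modcat C) (Phi Psi : modfun M N).
Local Notation T := (modtrans Phi Psi).
Implicit Types d e : T.

Lemma modtrans_eq d e : (forall X, d X = e X) -> d = e.
Proof.
case: d e => [d d1 d2] [e e1 e2] /= de.
have {}de : d = e by apply: functional_extensionality_dep.
by subst e; congr ModTrans.
Qed.

Fact modtrans_comb_nat a d e (X Y : M) (f : hom X Y) :
  (a *: d Y + e Y) ∘ fmap Phi f = fmap Psi f ∘ (a *: d X + e X).
Proof. by rewrite comp_linl comp_linr !mt_nat. Qed.

Fact modtrans_comb_str a d e F X :
  (a *: d (act M F X) + e (act M F X)) ∘ mf_str Phi F X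
  = mf_str Psi F X ∘ fmap (act N F) (a *: d X + e X).
Proof. by rewrite comp_linl fmap_lin comp_linr !mt_str. Qed.

Definition modtrans_comb a d e : T :=
  ModTrans (modtrans_comb_nat a d e) (modtrans_comb_str a d e).

Fact modtrans_zero_nat (X Y : M) (f : hom X Y) :
  (0 : hom (Phi Y) (Psi Y)) ∘ fmap Phi f = fmap Psi f ∘ 0.
Proof.
by rewrite (lin0 (comp_linr (fmap Psi f))) (lin0 (comp_linl (fmap Phi f))).
Qed.

Fact modtrans_zero_str F X :
  (0 : hom (Phi (act M F X)) (Psi (act M F X))) ∘ mf_str Phi F X
  = mf_str Psi F X ∘ fmap (act N F) 0.
Proof.
rewrite (lin0 (comp_linl (mf_str Phi F X))) (lin0 (@fmap_lin _ _ _ (act N F) _ _)).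
by rewrite (lin0 (comp_linr (mf_str Psi F X))).
Qed.

Definition modtrans_zero : T := ModTrans modtrans_zero_nat modtrans_zero_str.
Definition modtrans_add d e := modtrans_comb 1 d e.
Definition modtrans_scale a d := modtrans_comb a d modtrans_zero.
Definition modtrans_opp d := modtrans_scale (-1) d.

Fact modtrans_addA : associative modtrans_add.
Proof. by move=> d e f; apply: modtrans_eq => X /=; rewrite !scale1r addrA. Qed.
Fact modtrans_addC : commutative modtrans_add.
Proof. by move=> d e; apply: modtrans_eq => X /=; rewrite !scale1r addrC. Qed.
Fact modtrans_add0 : left_id modtrans_zero modtrans_add.
Proof. by move=> d; apply: modtrans_eq => X /=; rewrite scale1r add0r. Qed.
Fact modtrans_addN : left_inverse modtrans_zero modtrans_opp modtrans_add.
Proof.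
by move=> d; apply: modtrans_eq => X /=; rewrite scale1r addr0 scaleN1r addNr.
Qed.

HB.instance Definition _ := gen_eqMixin T.
HB.instance Definition _ := gen_choiceMixin T.
HB.instance Definition _ := GRing.isZmodule.Build T
  modtrans_addA modtrans_addC modtrans_add0 modtrans_addN.

Lemma modtrans_addE d e X : (d + e) X = d X + e X.
Proof. by rewrite /GRing.add /= scale1r. Qed.

Fact modtrans_scaleA a b d :
  modtrans_scale a (modtrans_scale b d) = modtrans_scale (a * b) d.
Proof. by apply: modtrans_eq => X /=; rewrite !addr0 scalerA. Qed.
Fact modtrans_scale1 : left_id 1 modtrans_scale.
Proof. by move=> d; apply: modtrans_eq => X /=; rewrite addr0 scale1r. Qed.
Fact modtrans_scaleDr : right_distributive modtrans_scale +%R.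
Proof.
move=> a d e; apply: modtrans_eq => X; rewrite modtrans_addE /=.
by rewrite !scale1r !addr0 scalerDr.
Qed.
Fact modtrans_scaleDl d : {morph modtrans_scale^~ d : a b / a + b}.
Proof.
move=> a b; apply: modtrans_eq => X; rewrite modtrans_addE /=.
by rewrite !addr0 scalerDl.
Qed.

HB.instance Definition _ := GRing.Zmodule_isLmodule.Build K T
  modtrans_scaleA modtrans_scale1 modtrans_scaleDr modtrans_scaleDl.

Lemma modtrans_combE a d e X : (a *: d + e) X = a *: d X + e X.
Proof. by rewrite modtrans_addE; congr (_ + _); rewrite /GRing.scale /= addr0. Qed.
End ModTransModule.

Section TambMorModule.
Variables (K : fieldType) (C : moncat K) (M N : modcat C) (P Q : tambara M N).
Local Notation T := (tambmor P Q).
Implicit Types d e : T.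

Lemma tambmor_eq d e : (forall Y X (p : pob P Y X), tm d p = tm e p) -> d = e.
Proof.
case: d e => [d d1 d2 d3] [e e1 e2 e3] /= de.
have {}de : d = e.
  apply: functional_extensionality_dep => Y.
  apply: functional_extensionality_dep => X.
  by apply: functional_extensionality_dep => p.
by subst e; congr TambMor.
Qed.

Fact tambmor_comb_lin a d e Y X : linear (fun p : pob P Y X => a *: tm d p + tm e p).
Proof. by apply: lin_comb; exact: tm_lin. Qed.
Fact tambmor_comb_nat a d e Y Y' X X' (f : hom Y' Y) (g : hom X X') (p : pob P Y X) :
  a *: tm d (pmap P f g p) + tm e (pmap P f g p)
  = pmap Q f g (a *: tm d p + tm e p).
Proof. by rewrite pmap_lin !tm_nat. Qed.
Fact tambmor_comb_str a d e H Y X (p : pob P Y X) :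
  a *: tm d (tstr P H p) + tm e (tstr P H p) = tstr Q H (a *: tm d p + tm e p).
Proof. by rewrite tstr_lin !tm_str. Qed.

Definition tambmor_comb a d e : T :=
  TambMor (tambmor_comb_lin a d e) (tambmor_comb_nat a d e)
          (tambmor_comb_str a d e).

Fact tambmor_zero_lin Y X : linear (fun _ : pob P Y X => (0 : pob Q Y X)).
Proof. by move=> b p q /=; rewrite scaler0 addr0. Qed.
Fact tambmor_zero_nat Y Y' X X' (f : hom Y' Y) (g : hom X X') (p : pob P Y X) :
  0 = pmap Q f g 0.
Proof. by rewrite (lin0 (pmap_lin f g)). Qed.
Fact tambmor_zero_str H Y X (p : pob P Y X) : 0 = tstr Q H (0 : pob Q Y X).
Proof. by rewrite (lin0 (@tstr_lin _ _ _ _ Q H Y X)). Qed.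

Definition tambmor_zero : T :=
  TambMor tambmor_zero_lin tambmor_zero_nat tambmor_zero_str.
Definition tambmor_add d e := tambmor_comb 1 d e.
Definition tambmor_scale a d := tambmor_comb a d tambmor_zero.
Definition tambmor_opp d := tambmor_scale (-1) d.

Fact tambmor_addA : associative tambmor_add.
Proof. by move=> d e f; apply: tambmor_eq => * /=; rewrite !scale1r addrA. Qed.
Fact tambmor_addC : commutative tambmor_add.
Proof. by move=> d e; apply: tambmor_eq => * /=; rewrite !scale1r addrC. Qed.
Fact tambmor_add0 : left_id tambmor_zero tambmor_add.
Proof. by move=> d; apply: tambmor_eq => * /=; rewrite scale1r add0r. Qed.
Fact tambmor_addN : left_inverse tambmor_zero tambmor_opp tambmor_add.
Proof.
by move=> d; apply: tambmor_eq => * /=; rewrite scale1r addr0 scaleN1r addNr.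
Qed.

HB.instance Definition _ := gen_eqMixin T.
HB.instance Definition _ := gen_choiceMixin T.
HB.instance Definition _ := GRing.isZmodule.Build T
  tambmor_addA tambmor_addC tambmor_add0 tambmor_addN.

Lemma tambmor_addE d e Y X (p : pob P Y X) : tm (d + e) p = tm d p + tm e p.
Proof. by rewrite /GRing.add /= scale1r. Qed.

Fact tambmor_scaleA a b d :
  tambmor_scale a (tambmor_scale b d) = tambmor_scale (a * b) d.
Proof. by apply: tambmor_eq => * /=; rewrite !addr0 scalerA. Qed.
Fact tambmor_scale1 : left_id 1 tambmor_scale.
Proof. by move=> d; apply: tambmor_eq => * /=; rewrite addr0 scale1r. Qed.
Fact tambmor_scaleDr : right_distributive tambmor_scale +%R.
Proof.
move=> a d e; apply: tambmor_eq => *; rewrite tambmor_addE /=.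
by rewrite !scale1r !addr0 scalerDr.
Qed.
Fact tambmor_scaleDl d : {morph tambmor_scale^~ d : a b / a + b}.
Proof.
move=> a b; apply: tambmor_eq => *; rewrite tambmor_addE /=.
by rewrite !addr0 scalerDl.
Qed.

HB.instance Definition _ := GRing.Zmodule_isLmodule.Build K T
  tambmor_scaleA tambmor_scale1 tambmor_scaleDr tambmor_scaleDl.

Lemma tambmor_combE a d e Y X (p : pob P Y X) :
  tm (a *: d + e) p = a *: tm d p + tm e p.
Proof. by rewrite tambmor_addE; congr (_ + _); rewrite /GRing.scale /= addr0. Qed.
End TambMorModule.

(* The coend of S b (x) T b over b in B, for S covariant and T contravariant.  *)
(* Its elements are classes of finite formal sums of pure tensors; two sums    *)
(* are identified when no family of bilinear maps S b -> T b -> W that is      *)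
(* balanced (dinatural) in b separates them.  coend_lift and coend_ext are the *)
(* universal property.                                                         *)
Section Coend.
Variables (K : fieldType) (B : lincat K) (S T : B -> lmodType K).
Variable Sm : forall b b', hom b b' -> S b -> S b'.
Variable Tm : forall b b', hom b b' -> T b' -> T b.

Definition balanced (W : lmodType K) (beta : forall b, S b -> T b -> W) : Prop :=
  [/\ forall b t, linear (fun s => beta b s t),
      forall b s, linear (fun t => beta b s t)
    & forall b b' (h : hom b b') s t, beta b' (Sm h s) t = beta b s (Tm h t)].

Definition formal_tensors : Type := seq {classic {b : B & (S b * T b)%type}}.

Definition tensor_eval (W : lmodType K) (beta : forall b, S b -> T b -> W)
    (r : formal_tensors) : W :=
  \sum_(u <- r) beta (tag u) (tagged u).1 (tagged u).2.

Definition coend_rel (r r' : formal_tensors) : bool :=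
  `[< forall (W : lmodType K) (beta : forall b, S b -> T b -> W),
        balanced beta -> tensor_eval beta r = tensor_eval beta r' >].

Fact coend_rel_equiv : equiv_class_of coend_rel.
Proof.
split=> [r|r r'|r r' r''].
- by apply/asboolP.
- by apply/asboolP/asboolP => rr' W beta bb; rewrite rr'.
- move=> /asboolP rr' /asboolP rr''; apply/asboolP => W beta bb.
  by rewrite rr' // rr''.
Qed.
Canonical coend_equiv := EquivRelPack coend_rel_equiv.

Definition coend : Type := {eq_quot coend_equiv}.
HB.instance Definition _ := EqQuotient.on coend.
HB.instance Definition _ := gen_choiceMixin coend.

Definition coend_class (r : formal_tensors) : coend := \pi_coend r.
Definition coend_eval (W : lmodType K) (beta : forall b, S b -> T b -> W)
  (x : coend) : W := tensor_eval beta (repr x).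

Lemma coend_evalE (W : lmodType K) (beta : forall b, S b -> T b -> W) r :
  balanced beta -> coend_eval beta (coend_class r) = tensor_eval beta r.
Proof.
move=> bb; rewrite /coend_eval.
have : coend_rel (repr (coend_class r)) r.
  by apply/(@eqquotP _ _ coend); rewrite reprK.
by move/asboolP; apply.
Qed.

Lemma coend_eq (x y : coend) :
  (forall (W : lmodType K) (beta : forall b, S b -> T b -> W), balanced beta ->
     coend_eval beta x = coend_eval beta y) -> x = y.
Proof.
move=> xy; rewrite -[x]reprK -[y]reprK; apply/(@eqquotP _ _ coend).
by apply/asboolP => W beta /xy.
Qed.

Definition coend_zero : coend := coend_class [::].
Definition coend_add (x y : coend) : coend := coend_class (repr x ++ repr y).
Definition coend_scale (a : K) (x : coend) : coend :=
  coend_class (map (fun u : {classic {b : B & (S b * T b)%type}} =>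
    existT (fun b => (S b * T b)%type) (tag u) (a *: (tagged u).1, (tagged u).2))
    (repr x)).

Lemma coend_zeroE (W : lmodType K) (beta : forall b, S b -> T b -> W) :
  balanced beta -> coend_eval beta coend_zero = 0.
Proof. by move=> bb; rewrite coend_evalE // /tensor_eval big_nil. Qed.
Lemma coend_addE (W : lmodType K) (beta : forall b, S b -> T b -> W) x y :
  balanced beta ->
  coend_eval beta (coend_add x y) = coend_eval beta x + coend_eval beta y.
Proof. by move=> bb; rewrite coend_evalE // /tensor_eval big_cat. Qed.
Lemma coend_scaleE (W : lmodType K) (beta : forall b, S b -> T b -> W) a x :
  balanced beta -> coend_eval beta (coend_scale a x) = a *: coend_eval beta x.
Proof.
move=> bb; rewrite coend_evalE // /tensor_eval big_map /coend_eval /tensor_eval.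
by rewrite scaler_sumr; apply: eq_bigr => u _ /=; case: bb => bl _ _; rewrite (linZ (bl _ _)).
Qed.
Let E := (coend_zeroE, coend_addE, coend_scaleE).

Fact coend_addA : associative coend_add.
Proof. by move=> x y z; apply: coend_eq => W b bb; rewrite !E // addrA. Qed.
Fact coend_addC : commutative coend_add.
Proof. by move=> x y; apply: coend_eq => W b bb; rewrite !E // addrC. Qed.
Fact coend_add0 : left_id coend_zero coend_add.
Proof. by move=> x; apply: coend_eq => W b bb; rewrite !E // add0r. Qed.
Fact coend_addN : left_inverse coend_zero (coend_scale (-1)) coend_add.
Proof. by move=> x; apply: coend_eq => W b bb; rewrite !E // scaleN1r addNr. Qed.

HB.instance Definition _ := GRing.isZmodule.Build coend
  coend_addA coend_addC coend_add0 coend_addN.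

Fact coend_scaleA a b x : coend_scale a (coend_scale b x) = coend_scale (a * b) x.
Proof. by apply: coend_eq => W c bb; rewrite !E // scalerA. Qed.
Fact coend_scale1 : left_id 1 coend_scale.
Proof. by move=> x; apply: coend_eq => W c bb; rewrite !E // scale1r. Qed.
Fact coend_scaleDr : right_distributive coend_scale +%R.
Proof.
by move=> a x y; apply: coend_eq => W c bb; rewrite ![_ + _]/(coend_add _ _) !E // scalerDr.
Qed.
Fact coend_scaleDl x : {morph coend_scale^~ x : a b / a + b}.
Proof.
move=> a b; apply: coend_eq => W c bb.
by rewrite [X in _ = coend_eval _ X]/(coend_add _ _) !E // scalerDl.
Qed.

HB.instance Definition _ := GRing.Zmodule_isLmodule.Build K coend
  coend_scaleA coend_scale1 coend_scaleDr coend_scaleDl.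

Definition ctens (b : B) (s : S b) (t : T b) : coend :=
  coend_class [:: existT (fun b => (S b * T b)%type) b (s, t)].

Definition coend_lift (W : lmodType K) (beta : forall b, S b -> T b -> W)
  (bb : balanced beta) (x : coend) : W := coend_eval beta x.

Lemma coend_lift_lin (W : lmodType K) (beta : forall b, S b -> T b -> W) (bb : balanced beta) :
  linear (coend_lift bb).
Proof.
move=> a x y; rewrite /coend_lift.
by rewrite [X in coend_eval _ X]/(coend_add _ _) !E.
Qed.

Lemma coend_liftE (W : lmodType K) (beta : forall b, S b -> T b -> W) (bb : balanced beta) b s t :
  coend_lift bb (@ctens b s t) = beta b s t.
Proof. by rewrite /coend_lift coend_evalE // /tensor_eval big_seq1. Qed.

Lemma ctens_evalE (W : lmodType K) (beta : forall b, S b -> T b -> W) b s t :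
  balanced beta -> coend_eval beta (@ctens b s t) = beta b s t.
Proof. by move=> bb; rewrite coend_evalE // /tensor_eval big_seq1. Qed.

Lemma ctens_balanced : balanced ctens.
Proof.
split=> [b t a s s'|b s a t t'|b b' h s t]; apply: coend_eq => W c bb.
- rewrite [X in _ = coend_eval _ X]/(coend_add _ _) !E // !ctens_evalE //.
  by case: bb => bl _ _; exact: bl.
- rewrite [X in _ = coend_eval _ X]/(coend_add _ _) !E // !ctens_evalE //.
  by case: bb => _ bl _; exact: bl.
- by rewrite !ctens_evalE //; case: bb.
Qed.

Lemma ctens_linl b (t : T b) : linear (fun s => ctens s t).
Proof. by case: ctens_balanced. Qed.
Lemma ctens_linr b (s : S b) : linear (fun t => ctens s t).
Proof. by case: ctens_balanced. Qed.
Lemma ctens_bal b b' (h : hom b b') s t : ctens (Sm h s) t = ctens s (Tm h t).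
Proof. by case: ctens_balanced. Qed.

Lemma coend_sum (x : coend) :
  x = \sum_(u <- repr x) ctens (tagged u).1 (tagged u).2.
Proof.
apply: coend_eq => W beta bb; rewrite -!/(coend_lift bb _).
rewrite (lin_sum (coend_lift_lin bb)) /coend_lift /coend_eval /tensor_eval.
by apply: eq_bigr => u _; rewrite -[RHS]/(coend_lift bb _) coend_liftE.
Qed.

Lemma coend_ext (W : lmodType K) (f g : coend -> W) : linear f -> linear g ->
  (forall b (s : S b) (t : T b), f (ctens s t) = g (ctens s t)) ->
  forall x, f x = g x.
Proof.
move=> fl gl fg x; rewrite (coend_sum x) (lin_sum fl) (lin_sum gl).
by apply: eq_bigr => u _.
Qed.
End Coend.

Section ModBicategory.
Variables (K : fieldType) (C : moncat K).

Fact is_iso_idm (D : lincat K) (x : D) : is_iso (idm x).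
Proof. by exists (idm x); split; rewrite comp1m. Qed.

Fact is_iso_comp (D : lincat K) (x y z : D) (g : hom y z) (f : hom x y) :
  is_iso g -> is_iso f -> is_iso (g ∘ f).
Proof.
move=> [g' [g1 g2]] [f' [f1 f2]]; exists (f' ∘ g'); split.
  by rewrite compA -(compA f') g1 compm1.
by rewrite compA -(compA g) f2 compm1.
Qed.

Fact is_iso_fmap (D E : lincat K) (F : linfunctor D E) (x y : D) (f : hom x y) :
  is_iso f -> is_iso (fmap F f).
Proof.
by move=> [g [gf fg]]; exists (fmap F g); split; rewrite -fmap_comp ?gf ?fg fmap_id.
Qed.

Definition functor_id (D : lincat K) : linfunctor D D :=
  @LinFunctor K D D (fun x => x) (fun x y f => f) (fun x y => @lin_id K (hom x y))
    (fun x => erefl) (fun x y z g f => erefl).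

Section FunctorComp.
Variables (D E H : lincat K) (G : linfunctor E H) (F : linfunctor D E).
Fact functor_comp_lin x y : linear (fun f : hom x y => fmap G (fmap F f)).
Proof. by apply: lin_comp; exact: fmap_lin. Qed.
Fact functor_comp_id x : fmap G (fmap F (idm x)) = idm (G (F x)).
Proof. by rewrite !fmap_id. Qed.
Fact functor_comp_comp x y z (g : hom y z) (f : hom x y) :
  fmap G (fmap F (g ∘ f)) = fmap G (fmap F g) ∘ fmap G (fmap F f).
Proof. by rewrite !fmap_comp. Qed.
Definition functor_comp : linfunctor D H :=
  LinFunctor functor_comp_lin functor_comp_id functor_comp_comp.
End FunctorComp.

Section ModFunId.
Variable M : modcat C.
Fact modfun_id_nat F (X Y : M) (f : hom X Y) :
  idm (act M F Y) ∘ fmap (act M F) f = fmap (act M F) f ∘ idm (act M F X).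
Proof. by rewrite comp1m compm1. Qed.
Fact modfun_id_natl (F G : C) (h : hom F G) (X : M) :
  idm (act M G X) ∘ actm h X = actm h X ∘ idm (act M F X).
Proof. by rewrite comp1m compm1. Qed.
Fact modfun_id_mul G F (X : M) :
  idm (act M (tens G F) X) ∘ actM G F X
  = actM G F X ∘ (idm (act M G (act M F X)) ∘ fmap (act M G) (idm (act M F X))).
Proof. by rewrite fmap_id !comp1m compm1. Qed.
Fact modfun_id_unit (X : M) : idm (act M mon1 X) ∘ act1 X = act1 X.
Proof. by rewrite comp1m. Qed.
Definition modfun_id : modfun M M :=
  @ModFun K C M M (functor_id M) (fun F X => idm (act M F X))
    (fun F X => is_iso_idm _) modfun_id_nat modfun_id_natl modfun_id_mul modfun_id_unit.
End ModFunId.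

Section ModFunComp.
Variables (M N L : modcat C) (Psi : modfun N L) (Phi : modfun M N).
Definition modfun_comp_str (F : C) (X : M) :
  hom (act L F (Psi (Phi X))) (Psi (Phi (act M F X))) :=
  fmap Psi (mf_str Phi F X) ∘ mf_str Psi F (Phi X).
Fact modfun_comp_iso F X : is_iso (modfun_comp_str F X).
Proof. by apply: is_iso_comp; [apply: is_iso_fmap|]; apply: mf_iso. Qed.
Fact modfun_comp_nat F (X Y : M) (f : hom X Y) :
  modfun_comp_str F Y ∘ fmap (act L F) (fmap Psi (fmap Phi f))
  = fmap Psi (fmap Phi (fmap (act M F) f)) ∘ modfun_comp_str F X.
Proof.
by rewrite /modfun_comp_str -compA mf_nat !compA -!fmap_comp mf_nat.
Qed.
Fact modfun_comp_natl (F G : C) (h : hom F G) X :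
  modfun_comp_str G X ∘ actm h (Psi (Phi X))
  = fmap Psi (fmap Phi (actm h X)) ∘ modfun_comp_str F X.
Proof.
by rewrite /modfun_comp_str -compA mf_natl !compA -!fmap_comp mf_natl.
Qed.
Fact modfun_comp_mul G F X :
  modfun_comp_str (tens G F) X ∘ actM G F (Psi (Phi X))
  = fmap Psi (fmap Phi (actM G F X)) ∘ (modfun_comp_str G (act M F X)
      ∘ fmap (act L G) (modfun_comp_str F X)).
Proof.
rewrite /modfun_comp_str -compA mf_mul !compA -fmap_comp mf_mul.
rewrite !fmap_comp -!compA; congr (_ ∘ (_ ∘ _)).
by rewrite compA -mf_nat -compA.
Qed.
Fact modfun_comp_unit X :
  modfun_comp_str mon1 X ∘ act1 (Psi (Phi X)) = fmap Psi (fmap Phi (act1 X)).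
Proof. by rewrite /modfun_comp_str -compA mf_unit -fmap_comp mf_unit. Qed.
Definition modfun_comp : modfun M L :=
  @ModFun K C M L (functor_comp Psi Phi) modfun_comp_str modfun_comp_iso
    modfun_comp_nat modfun_comp_natl modfun_comp_mul modfun_comp_unit.
End ModFunComp.

Section ModTransOps.
Variables (M N : modcat C).

Section Id.
Variable Phi : modfun M N.
Fact modtrans_id_nat (X Y : M) (f : hom X Y) :
  idm (Phi Y) ∘ fmap Phi f = fmap Phi f ∘ idm (Phi X).
Proof. by rewrite comp1m compm1. Qed.
Fact modtrans_id_str F X :
  idm (Phi (act M F X)) ∘ mf_str Phi F X
  = mf_str Phi F X ∘ fmap (act N F) (idm (Phi X)).
Proof. by rewrite fmap_id comp1m compm1. Qed.
Definition modtrans_id : modtrans Phi Phi :=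
  ModTrans modtrans_id_nat modtrans_id_str.
End Id.

Section Vcomp.
Variables (Phi Psi Xi : modfun M N) (e : modtrans Psi Xi) (d : modtrans Phi Psi).
Fact modtrans_vcomp_nat (X Y : M) (f : hom X Y) :
  e Y ∘ d Y ∘ fmap Phi f = fmap Xi f ∘ (e X ∘ d X).
Proof. by rewrite -compA mt_nat !compA mt_nat. Qed.
Fact modtrans_vcomp_str F X :
  e (act M F X) ∘ d (act M F X) ∘ mf_str Phi F X
  = mf_str Xi F X ∘ fmap (act N F) (e X ∘ d X).
Proof. by rewrite -compA mt_str !compA mt_str fmap_comp compA. Qed.
Definition modtrans_vcomp : modtrans Phi Xi :=
  ModTrans modtrans_vcomp_nat modtrans_vcomp_str.
Lemma modtrans_vcompE X : modtrans_vcomp X = e X ∘ d X.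
Proof. by []. Qed.
End Vcomp.

End ModTransOps.

Section Hcomp.
Variables (M N L : modcat C) (Psi Psi' : modfun N L) (Phi Phi' : modfun M N).
Variables (e : modtrans Psi Psi') (d : modtrans Phi Phi').
Definition modtrans_hcomp_fun (X : M) : hom (Psi (Phi X)) (Psi' (Phi' X)) :=
  fmap Psi' (d X) ∘ e (Phi X).
Fact modtrans_hcomp_nat (X Y : M) (f : hom X Y) :
  modtrans_hcomp_fun Y ∘ fmap Psi (fmap Phi f)
  = fmap Psi' (fmap Phi' f) ∘ modtrans_hcomp_fun X.
Proof.
by rewrite /modtrans_hcomp_fun -compA mt_nat !compA -!fmap_comp mt_nat.
Qed.
Fact modtrans_hcomp_str F X :
  modtrans_hcomp_fun (act M F X) ∘ modfun_comp_str Psi Phi F X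
  = modfun_comp_str Psi' Phi' F X ∘ fmap (act L F) (modtrans_hcomp_fun X).
Proof.
rewrite /modtrans_hcomp_fun /modfun_comp_str fmap_comp.
rewrite -compA (compA (e _)) mt_nat -!compA mt_str.
rewrite (compA (fmap Psi' (d _))) -fmap_comp mt_str fmap_comp -!compA.
congr (_ ∘ _); by rewrite !compA mf_nat.
Qed.
Definition modtrans_hcomp :
    modtrans (modfun_comp Psi Phi) (modfun_comp Psi' Phi') :=
  @ModTrans K C M L (modfun_comp Psi Phi) (modfun_comp Psi' Phi')
    modtrans_hcomp_fun modtrans_hcomp_nat modtrans_hcomp_str.
Lemma modtrans_hcompE X : modtrans_hcomp X = fmap Psi' (d X) ∘ e (Phi X).
Proof. by []. Qed.
End Hcomp.

Section Constraints.
Variables (M N L Q : modcat C).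
Variables (Xi : modfun L Q) (Psi : modfun N L) (Phi : modfun M N).

Fact modtrans_assoc_str F X :
  idm _ ∘ modfun_comp_str (modfun_comp Xi Psi) Phi F X
  = modfun_comp_str Xi (modfun_comp Psi Phi) F X ∘ fmap (act Q F) (idm _).
Proof.
by rewrite fmap_id comp1m compm1 /modfun_comp_str /= /modfun_comp_str fmap_comp compA.
Qed.
Definition modtrans_assoc : modtrans (modfun_comp (modfun_comp Xi Psi) Phi)
    (modfun_comp Xi (modfun_comp Psi Phi)) :=
  @ModTrans K C M Q (modfun_comp (modfun_comp Xi Psi) Phi)
    (modfun_comp Xi (modfun_comp Psi Phi)) (fun X => idm (Xi (Psi (Phi X))))
    (@modtrans_id_nat M Q (modfun_comp (modfun_comp Xi Psi) Phi)) modtrans_assoc_str.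

Fact modtrans_assocV_str F X :
  idm _ ∘ modfun_comp_str Xi (modfun_comp Psi Phi) F X
  = modfun_comp_str (modfun_comp Xi Psi) Phi F X ∘ fmap (act Q F) (idm _).
Proof.
by rewrite fmap_id comp1m compm1 /modfun_comp_str /= /modfun_comp_str fmap_comp compA.
Qed.
Definition modtrans_assocV : modtrans (modfun_comp Xi (modfun_comp Psi Phi))
    (modfun_comp (modfun_comp Xi Psi) Phi) :=
  @ModTrans K C M Q (modfun_comp Xi (modfun_comp Psi Phi))
    (modfun_comp (modfun_comp Xi Psi) Phi) (fun X => idm (Xi (Psi (Phi X))))
    (@modtrans_id_nat M Q (modfun_comp (modfun_comp Xi Psi) Phi)) modtrans_assocV_str.

Fact modtrans_lunit_str F X :
  idm _ ∘ modfun_comp_str (modfun_id N) Phi F X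
  = mf_str Phi F X ∘ fmap (act N F) (idm _).
Proof. by rewrite fmap_id comp1m /modfun_comp_str /=. Qed.
Definition modtrans_lunit : modtrans (modfun_comp (modfun_id N) Phi) Phi :=
  @ModTrans K C M N (modfun_comp (modfun_id N) Phi) Phi (fun X => idm (Phi X))
    (modtrans_id_nat Phi) modtrans_lunit_str.

Fact modtrans_lunitV_str F X :
  idm _ ∘ mf_str Phi F X
  = modfun_comp_str (modfun_id N) Phi F X ∘ fmap (act N F) (idm _).
Proof. by rewrite fmap_id comp1m /modfun_comp_str /= !compm1. Qed.
Definition modtrans_lunitV : modtrans Phi (modfun_comp (modfun_id N) Phi) :=
  @ModTrans K C M N Phi (modfun_comp (modfun_id N) Phi) (fun X => idm (Phi X))
    (modtrans_id_nat Phi) modtrans_lunitV_str.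

Fact modtrans_runit_str F X :
  idm _ ∘ modfun_comp_str Phi (modfun_id M) F X
  = mf_str Phi F X ∘ fmap (act N F) (idm _).
Proof. by rewrite fmap_id comp1m /modfun_comp_str /= fmap_id comp1m compm1. Qed.
Definition modtrans_runit : modtrans (modfun_comp Phi (modfun_id M)) Phi :=
  @ModTrans K C M N (modfun_comp Phi (modfun_id M)) Phi (fun X => idm (Phi X))
    (modtrans_id_nat Phi) modtrans_runit_str.

Fact modtrans_runitV_str F X :
  idm _ ∘ mf_str Phi F X
  = modfun_comp_str Phi (modfun_id M) F X ∘ fmap (act N F) (idm _).
Proof. by rewrite fmap_id comp1m /modfun_comp_str /= fmap_id comp1m compm1. Qed.
Definition modtrans_runitV : modtrans Phi (modfun_comp Phi (modfun_id M)) :=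
  @ModTrans K C M N Phi (modfun_comp Phi (modfun_id M)) (fun X => idm (Phi X))
    (modtrans_id_nat Phi) modtrans_runitV_str.
End Constraints.

Definition CMod : bicategory K (modcat C).
Proof.
refine (@Bicategory K (modcat C)
  (@modfun K C) (fun M N Phi Psi => modtrans Phi Psi : lmodType K)
  modtrans_id modtrans_vcomp modfun_id modfun_comp modtrans_hcomp
  modtrans_assoc modtrans_assocV modtrans_lunit modtrans_lunitV
  modtrans_runit modtrans_runitV
  _ _ _ _ _ _ _ _ _ _ _ _ _ _ _ _ _ _ _ _).
- move=> M N Phi Psi Xi d a e e'; apply: modtrans_eq => X.
  by rewrite [RHS]modtrans_combE !modtrans_vcompE modtrans_combE comp_linl.
- move=> M N Phi Psi Xi e a d d'; apply: modtrans_eq => X.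
  by rewrite [RHS]modtrans_combE !modtrans_vcompE modtrans_combE comp_linr.
- by move=> *; apply: modtrans_eq => X /=; rewrite compA.
- by move=> *; apply: modtrans_eq => X /=; rewrite comp1m.
- by move=> *; apply: modtrans_eq => X /=; rewrite compm1.
- move=> M N L Psi Psi' Phi Phi' d a e e'; apply: modtrans_eq => X.
  by rewrite [RHS]modtrans_combE !modtrans_hcompE modtrans_combE comp_linr.
- move=> M N L Psi Psi' Phi Phi' e a d d'; apply: modtrans_eq => X.
  by rewrite [RHS]modtrans_combE !modtrans_hcompE modtrans_combE fmap_lin comp_linl.
- move=> *; apply: modtrans_eq => X /=.
  by rewrite /modtrans_hcomp_fun /= fmap_id comp1m.
- move=> M N L P P' P'' Q Q' Q'' e' e d' d; apply: modtrans_eq => X /=.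
  rewrite /modtrans_hcomp_fun /= fmap_comp -!compA; congr (_ ∘ _).
  by rewrite !compA mt_nat.
- by move=> *; apply: modtrans_eq => X /=; rewrite comp1m.
- by move=> *; apply: modtrans_eq => X /=; rewrite comp1m.
- by move=> *; apply: modtrans_eq => X /=; rewrite comp1m.
- by move=> *; apply: modtrans_eq => X /=; rewrite comp1m.
- by move=> *; apply: modtrans_eq => X /=; rewrite comp1m.
- by move=> *; apply: modtrans_eq => X /=; rewrite comp1m.
- move=> *; apply: modtrans_eq => X /=.
  by rewrite /modtrans_hcomp_fun /= /modtrans_hcomp_fun fmap_comp comp1m compm1 compA.
- move=> *; apply: modtrans_eq => X /=.
  by rewrite /modtrans_hcomp_fun /= comp1m.
- move=> *; apply: modtrans_eq => X /=.
  by rewrite /modtrans_hcomp_fun /= fmap_id !comp1m compm1.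
- move=> *; apply: modtrans_eq => X /=.
  by rewrite /modtrans_hcomp_fun /= !fmap_id !comp1m.
- move=> *; apply: modtrans_eq => X /=.
  by rewrite /modtrans_hcomp_fun /= !fmap_id !comp1m.
Defined.

End ModBicategory.

Section TambBicategory.
Variables (K : fieldType) (C : moncat K).

Lemma pmap_split (M N : modcat C) (P : tambara M N) Y Y' X X'
    (f : hom Y' Y) (g : hom X X') (p : pob P Y X) :
  pmap P f g p = pmap P f (idm X') (pmap P (idm Y) g p).
Proof. by rewrite -pmap_comp !comp1m. Qed.

Section TambId.
Variable M : modcat C.
Definition tamb_id_map (Y Y' X X' : M) (f : hom Y' Y) (g : hom X X') (p : hom Y X) :
  hom Y' X' := g ∘ p ∘ f.
Definition tamb_id_str (H : C) (Y X : M) (p : hom Y X) : hom (act M H Y) (act M H X) :=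
  fmap (act M H) p.
Fact tamb_id_lin (Y Y' X X' : M) (f : hom Y' Y) (g : hom X X') :
  linear (tamb_id_map f g).
Proof.
by apply: (@lin_comp _ _ _ _ (fun p => p ∘ f)); [apply: comp_linl|apply: comp_linr].
Qed.
Fact tamb_id_linl (Y Y' X X' : M) (g : hom X X') (p : hom Y X) :
  linear (fun f : hom Y' Y => tamb_id_map f g p).
Proof. exact: comp_linr. Qed.
Fact tamb_id_linr (Y Y' X X' : M) (f : hom Y' Y) (p : hom Y X) :
  linear (fun g : hom X X' => tamb_id_map f g p).
Proof.
by apply: (@lin_comp _ _ _ _ (fun p => p ∘ f)); apply: comp_linl.
Qed.
Fact tamb_id_id (Y X : M) (p : hom Y X) : tamb_id_map (idm Y) (idm X) p = p.
Proof. by rewrite /tamb_id_map comp1m compm1. Qed.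
Fact tamb_id_comp (Y Y' Y'' X X' X'' : M) (f' : hom Y'' Y') (f : hom Y' Y)
    (g' : hom X' X'') (g : hom X X') (p : hom Y X) :
  tamb_id_map (f ∘ f') (g' ∘ g) p = tamb_id_map f' g' (tamb_id_map f g p).
Proof. by rewrite /tamb_id_map !compA. Qed.
Fact tamb_id_str_lin H (Y X : M) : linear (@tamb_id_str H Y X).
Proof. exact: fmap_lin. Qed.
Fact tamb_id_str_nat H (Y Y' X X' : M) (f : hom Y' Y) (g : hom X X') (p : hom Y X) :
  tamb_id_str H (tamb_id_map f g p)
  = tamb_id_map (fmap (act M H) f) (fmap (act M H) g) (tamb_id_str H p).
Proof. by rewrite /tamb_id_str /tamb_id_map !fmap_comp. Qed.
Fact tamb_id_extranat (H H' : C) (h : hom H H') (Y X : M) (p : hom Y X) :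
  tamb_id_map (idm (act M H Y)) (actm h X) (tamb_id_str H p)
  = tamb_id_map (actm h Y) (idm (act M H' X)) (tamb_id_str H' p).
Proof. by rewrite /tamb_id_str /tamb_id_map compm1 comp1m actm_nat. Qed.
Fact tamb_id_mul G F (Y X : M) (p : hom Y X) :
  tamb_id_map (actM G F Y) (idm (act M (tens G F) X)) (tamb_id_str (tens G F) p)
  = tamb_id_map (idm (act M G (act M F Y))) (actM G F X)
      (tamb_id_str G (tamb_id_str F p)).
Proof. by rewrite /tamb_id_str /tamb_id_map compm1 comp1m actM_nat. Qed.
Fact tamb_id_unit (Y X : M) (p : hom Y X) :
  tamb_id_map (act1 Y) (act1V X) (tamb_id_str mon1 p) = p.
Proof.
rewrite /tamb_id_str /tamb_id_map -compA -act1_nat compA.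
by case: (act1_inv X) => -> _; rewrite comp1m.
Qed.
Definition tamb_id : tambara M M :=
  @Tambara K C M M (fun Y X => hom Y X) tamb_id_map
    tamb_id_lin tamb_id_linl tamb_id_linr tamb_id_id tamb_id_comp
    tamb_id_str tamb_id_str_lin tamb_id_str_nat tamb_id_extranat
    tamb_id_mul tamb_id_unit.
End TambId.

Section TambComp.
Variables (M N L : modcat C) (Psi : tambara N L) (Phi : tambara M N).

Definition tamb_comp_ob (Z : L) (X : M) : lmodType K :=
  @coend K N (fun Y => pob Psi Z Y) (fun Y => pob Phi Y X)
    (fun Y Y' h => pmap Psi (idm Z) h) (fun Y Y' h => pmap Phi h (idm X)).

Definition ptens (Z : L) (X : M) (Y : N) (s : pob Psi Z Y) (t : pob Phi Y X) :
  tamb_comp_ob Z X := ctens _ _ s t.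

Lemma ptens_linl Z X Y (t : pob Phi Y X) : linear (fun s : pob Psi Z Y => ptens s t).
Proof. exact: ctens_linl. Qed.
Lemma ptens_linr Z X Y (s : pob Psi Z Y) : linear (fun t : pob Phi Y X => ptens s t).
Proof. by move=> a t t'; rewrite /ptens ctens_linr. Qed.
Lemma ptens_bal Z X Y Y' (h : hom Y Y') (s : pob Psi Z Y) (t : pob Phi Y' X) :
  ptens (pmap Psi (idm Z) h s) t = ptens s (pmap Phi h (idm X) t).
Proof.
exact: (ctens_bal (fun Y Y' h => pmap Psi (idm Z) h)
                  (fun Y Y' h => pmap Phi h (idm X)) h).
Qed.

Definition pbalanced (Z : L) (X : M) (W : lmodType K)
    (beta : forall Y, pob Psi Z Y -> pob Phi Y X -> W) : Prop :=
  balanced (fun Y Y' (h : hom Y Y') => pmap Psi (idm Z) h)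
           (fun Y Y' (h : hom Y Y') => pmap Phi h (idm X)) beta.

Definition plift (Z : L) (X : M) (W : lmodType K)
    (beta : forall Y, pob Psi Z Y -> pob Phi Y X -> W) (bb : pbalanced beta) :
    tamb_comp_ob Z X -> W := coend_lift bb.

Lemma plift_lin Z X (W : lmodType K)
    (beta : forall Y, pob Psi Z Y -> pob Phi Y X -> W) (bb : pbalanced beta) :
  linear (plift bb).
Proof. exact: coend_lift_lin. Qed.

Lemma pliftE Z X (W : lmodType K)
    (beta : forall Y, pob Psi Z Y -> pob Phi Y X -> W) (bb : pbalanced beta)
    Y (s : pob Psi Z Y) (t : pob Phi Y X) :
  plift bb (ptens s t) = beta Y s t.
Proof. exact: (coend_liftE bb). Qed.

Lemma ptens_ext Z X (W : lmodType K) (f g : tamb_comp_ob Z X -> W) :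
  linear f -> linear g ->
  (forall Y (s : pob Psi Z Y) (t : pob Phi Y X), f (ptens s t) = g (ptens s t)) ->
  forall x, f x = g x.
Proof. by move=> fl gl fg; apply: coend_ext. Qed.

Section Map.
Variables (Z Z' : L) (X X' : M) (f : hom Z' Z) (g : hom X X').
Fact tamb_comp_map_bal : pbalanced (fun Y (s : pob Psi Z Y) (t : pob Phi Y X) =>
  ptens (pmap Psi f (idm Y) s) (pmap Phi (idm Y) g t)).
Proof.
split=> [Y t|Y s|Y Y' h s t].
- by apply: (lin_comp (ptens_linl _)); apply: pmap_lin.
- by apply: (lin_comp (ptens_linr _)); apply: pmap_lin.
- rewrite -!pmap_comp !comp1m !compm1.
  have -> : pmap Psi f h s = pmap Psi (idm Z') h (pmap Psi f (idm Y) s).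
    by rewrite -pmap_comp !compm1.
  by rewrite ptens_bal -pmap_comp !comp1m.
Qed.
Definition tamb_comp_map : tamb_comp_ob Z X -> tamb_comp_ob Z' X' :=
  plift tamb_comp_map_bal.
Lemma tamb_comp_mapE Y (s : pob Psi Z Y) (t : pob Phi Y X) :
  tamb_comp_map (ptens s t) = ptens (pmap Psi f (idm Y) s) (pmap Phi (idm Y) g t).
Proof. by rewrite /tamb_comp_map pliftE. Qed.
Fact tamb_comp_lin : linear tamb_comp_map.
Proof. exact: plift_lin. Qed.
End Map.

Section Str.
Variables (H : C) (Z : L) (X : M).
Fact tamb_comp_str_bal : pbalanced (fun Y (s : pob Psi Z Y) (t : pob Phi Y X) =>
  (ptens (tstr Psi H s) (tstr Phi H t))).
Proof.
split=> [Y t|Y s|Y Y' h s t].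
- by apply: (lin_comp (ptens_linl _)); apply: tstr_lin.
- by apply: (lin_comp (ptens_linr _)); apply: tstr_lin.
- by rewrite !tstr_nat !fmap_id ptens_bal.
Qed.
Definition tamb_comp_str :
    tamb_comp_ob Z X -> tamb_comp_ob (act L H Z) (act M H X) :=
  plift tamb_comp_str_bal.
Lemma tamb_comp_strE Y (s : pob Psi Z Y) (t : pob Phi Y X) :
  tamb_comp_str (ptens s t) = ptens (tstr Psi H s) (tstr Phi H t).
Proof. by rewrite /tamb_comp_str pliftE. Qed.
Fact tamb_comp_str_lin : linear tamb_comp_str.
Proof. exact: plift_lin. Qed.
End Str.

Fact tamb_comp_linl Z Z' X X' (g : hom X X') (x : tamb_comp_ob Z X) :
  linear (fun f : hom Z' Z => tamb_comp_map f g x).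
Proof.
move=> a f f'; move: x; apply: ptens_ext.
- exact: tamb_comp_lin.
- by apply: lin_comb; apply: tamb_comp_lin.
- by move=> Y s t; rewrite !tamb_comp_mapE pmap_linl ptens_linl.
Qed.
Fact tamb_comp_linr Z Z' X X' (f : hom Z' Z) (x : tamb_comp_ob Z X) :
  linear (fun g : hom X X' => tamb_comp_map f g x).
Proof.
move=> a g g'; move: x; apply: ptens_ext.
- exact: tamb_comp_lin.
- by apply: lin_comb; apply: tamb_comp_lin.
- by move=> Y s t; rewrite !tamb_comp_mapE pmap_linr ptens_linr.
Qed.
Fact tamb_comp_id Z X (x : tamb_comp_ob Z X) : tamb_comp_map (idm Z) (idm X) x = x.
Proof.
move: x; apply: ptens_ext; [exact: tamb_comp_lin|exact: lin_id|move=> Y s t].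
by rewrite tamb_comp_mapE !pmap_id.
Qed.
Fact tamb_comp_comp Z Z' Z'' X X' X'' (f' : hom Z'' Z') (f : hom Z' Z)
    (g' : hom X' X'') (g : hom X X') (x : tamb_comp_ob Z X) :
  tamb_comp_map (f ∘ f') (g' ∘ g) x = tamb_comp_map f' g' (tamb_comp_map f g x).
Proof.
move: x; apply: ptens_ext; first exact: tamb_comp_lin.
  by apply: lin_comp; apply: tamb_comp_lin.
by move=> Y s t; rewrite !tamb_comp_mapE -!pmap_comp !comp1m.
Qed.
Fact tamb_comp_str_nat H Z Z' X X' (f : hom Z' Z) (g : hom X X') (x : tamb_comp_ob Z X) :
  tamb_comp_str H (tamb_comp_map f g x)
  = tamb_comp_map (fmap (act L H) f) (fmap (act M H) g) (tamb_comp_str H x).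
Proof.
move: x; apply: ptens_ext.
- by apply: lin_comp; [exact: tamb_comp_str_lin|exact: tamb_comp_lin].
- by apply: lin_comp; [exact: tamb_comp_lin|exact: tamb_comp_str_lin].
move=> Y s t; rewrite tamb_comp_mapE !tamb_comp_strE tamb_comp_mapE.
by rewrite !tstr_nat !fmap_id.
Qed.
Fact tamb_comp_extranat (H H' : C) (h : hom H H') Z X (x : tamb_comp_ob Z X) :
  tamb_comp_map (idm (act L H Z)) (actm h X) (tamb_comp_str H x)
  = tamb_comp_map (actm h Z) (idm (act M H' X)) (tamb_comp_str H' x).
Proof.
move: x; apply: ptens_ext.
- by apply: lin_comp; [exact: tamb_comp_lin|exact: tamb_comp_str_lin].
- by apply: lin_comp; [exact: tamb_comp_lin|exact: tamb_comp_str_lin].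
move=> Y s t; rewrite !tamb_comp_strE !tamb_comp_mapE.
rewrite !pmap_id tstr_extranat -ptens_bal.
by rewrite tstr_extranat.
Qed.
Fact tamb_comp_mul G F Z X (x : tamb_comp_ob Z X) :
  tamb_comp_map (actM G F Z) (idm (act M (tens G F) X)) (tamb_comp_str (tens G F) x)
  = tamb_comp_map (idm (act L G (act L F Z))) (actM G F X)
      (tamb_comp_str G (tamb_comp_str F x)).
Proof.
move: x; apply: ptens_ext.
- by apply: lin_comp; [exact: tamb_comp_lin|exact: tamb_comp_str_lin].
- apply: lin_comp; first exact: tamb_comp_lin.
  by apply: lin_comp; exact: tamb_comp_str_lin.
move=> Y s t; rewrite !tamb_comp_strE !tamb_comp_mapE.
by rewrite pmap_id tstr_mul ptens_bal tstr_mul pmap_id.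
Qed.
Fact tamb_comp_unit Z X (x : tamb_comp_ob Z X) :
  tamb_comp_map (act1 Z) (act1V X) (tamb_comp_str mon1 x) = x.
Proof.
move: x; apply: ptens_ext; last move=> Y s t.
- by apply: lin_comp; [exact: tamb_comp_lin|exact: tamb_comp_str_lin].
- exact: lin_id.
rewrite tamb_comp_strE tamb_comp_mapE.
have -> : pmap Psi (act1 Z) (idm (act N mon1 Y)) (tstr Psi mon1 s)
        = pmap Psi (idm Z) (act1 Y) s.
  rewrite -[s in RHS](tstr_unit s) -pmap_comp compm1.
  by case: (act1_inv Y) => _ ->.
by rewrite ptens_bal -pmap_comp !comp1m tstr_unit.
Qed.

Definition tamb_comp : tambara M L :=
  @Tambara K C M L tamb_comp_ob tamb_comp_map
    tamb_comp_lin tamb_comp_linl tamb_comp_linr tamb_comp_id tamb_comp_comp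
    tamb_comp_str tamb_comp_str_lin tamb_comp_str_nat tamb_comp_extranat
    tamb_comp_mul tamb_comp_unit.

Section Lift.
Variables (Q : tambara M L).
Variable beta : forall Z X Y, pob Psi Z Y -> pob Phi Y X -> pob Q Z X.
Hypothesis bb : forall Z X, pbalanced (@beta Z X).
Hypothesis beta_nat : forall Z Z' X X' (f : hom Z' Z) (g : hom X X') Y
    (s : pob Psi Z Y) (t : pob Phi Y X),
  beta (pmap Psi f (idm Y) s) (pmap Phi (idm Y) g t) = pmap Q f g (beta s t).
Hypothesis beta_str : forall H Z X Y (s : pob Psi Z Y) (t : pob Phi Y X),
  beta (tstr Psi H s) (tstr Phi H t) = tstr Q H (beta s t).

Definition tlift_fun Z X : pob tamb_comp Z X -> pob Q Z X := plift (bb Z X).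
Fact tlift_lin Z X : linear (@tlift_fun Z X).
Proof. exact: plift_lin. Qed.
Fact tlift_nat Z Z' X X' (f : hom Z' Z) (g : hom X X') (x : pob tamb_comp Z X) :
  tlift_fun (pmap tamb_comp f g x) = pmap Q f g (tlift_fun x).
Proof.
move: x; apply: ptens_ext.
- by apply: lin_comp; [exact: tlift_lin|exact: tamb_comp_lin].
- by apply: lin_comp; [exact: pmap_lin|exact: tlift_lin].
by move=> Y s t; rewrite /= tamb_comp_mapE /tlift_fun !pliftE beta_nat.
Qed.
Fact tlift_str H Z X (x : pob tamb_comp Z X) :
  tlift_fun (tstr tamb_comp H x) = tstr Q H (tlift_fun x).
Proof.
move: x; apply: ptens_ext.
- by apply: lin_comp; [exact: tlift_lin|exact: tamb_comp_str_lin].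
- by apply: lin_comp; [exact: tstr_lin|exact: tlift_lin].
by move=> Y s t; rewrite /= tamb_comp_strE /tlift_fun !pliftE beta_str.
Qed.
Definition tlift : tambmor tamb_comp Q := TambMor tlift_lin tlift_nat tlift_str.
Lemma tliftE Z X Y (s : pob Psi Z Y) (t : pob Phi Y X) :
  tm tlift (ptens s t) = beta s t.
Proof. by rewrite /= /tlift_fun pliftE. Qed.
End Lift.

Lemma tm_ptens_linl (Q : tambara M L) (d : tambmor tamb_comp Q) Z X Y (t : pob Phi Y X) :
  linear (fun s : pob Psi Z Y => tm d (ptens s t)).
Proof. by move=> a s s'; rewrite ptens_linl tm_lin. Qed.
Lemma tm_ptens_linr (Q : tambara M L) (d : tambmor tamb_comp Q) Z X Y (s : pob Psi Z Y) :
  linear (fun t : pob Phi Y X => tm d (ptens s t)).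
Proof. by move=> a t t'; rewrite ptens_linr tm_lin. Qed.

Lemma tambmor_ext (Q : tambara M L) (d e : tambmor tamb_comp Q) :
  (forall Z X Y (s : pob Psi Z Y) (t : pob Phi Y X),
     tm d (ptens s t) = tm e (ptens s t)) -> d = e.
Proof.
move=> de; apply: tambmor_eq => Z X.
exact: (ptens_ext (@tm_lin _ _ _ _ _ _ d Z X) (@tm_lin _ _ _ _ _ _ e Z X) (@de Z X)).
Qed.

End TambComp.

Section TambMorOps.
Variables (M N : modcat C).

Definition tambmor_id (P : tambara M N) : tambmor P P :=
  @TambMor K C M N P P (fun Y X p => p) (fun Y X => @lin_id K (pob P Y X))
    (fun _ _ _ _ _ _ _ => erefl) (fun _ _ _ _ => erefl).

Section Vcomp.
Variables (P Q R : tambara M N) (e : tambmor Q R) (d : tambmor P Q).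
Fact tambmor_vcomp_lin Y X : linear (fun p : pob P Y X => tm e (tm d p)).
Proof. by apply: lin_comp; apply: tm_lin. Qed.
Fact tambmor_vcomp_nat Y Y' X X' (f : hom Y' Y) (g : hom X X') (p : pob P Y X) :
  tm e (tm d (pmap P f g p)) = pmap R f g (tm e (tm d p)).
Proof. by rewrite !tm_nat. Qed.
Fact tambmor_vcomp_str H Y X (p : pob P Y X) :
  tm e (tm d (tstr P H p)) = tstr R H (tm e (tm d p)).
Proof. by rewrite !tm_str. Qed.
Definition tambmor_vcomp : tambmor P R :=
  TambMor tambmor_vcomp_lin tambmor_vcomp_nat tambmor_vcomp_str.
Lemma tambmor_vcompE Y X (p : pob P Y X) : tm tambmor_vcomp p = tm e (tm d p).
Proof. by []. Qed.
End Vcomp.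
End TambMorOps.

Section TambHcomp.
Variables (M N L : modcat C) (Psi Psi' : tambara N L) (Phi Phi' : tambara M N).
Variables (e : tambmor Psi Psi') (d : tambmor Phi Phi').
Definition hcomp_beta Z X Y (s : pob Psi Z Y) (t : pob Phi Y X) :
  pob (tamb_comp Psi' Phi') Z X := ptens (tm e s) (tm d t).
Fact tambmor_hcomp_bal Z X : pbalanced (@hcomp_beta Z X).
Proof.
rewrite /hcomp_beta.
split=> [Y t|Y s|Y Y' h s t].
- by apply: (lin_comp (ptens_linl _)); apply: tm_lin.
- by apply: (lin_comp (ptens_linr _)); apply: tm_lin.
- by rewrite !tm_nat ptens_bal.
Qed.
Fact tambmor_hcomp_nat Z Z' X X' (f : hom Z' Z) (g : hom X X') Y
    (s : pob Psi Z Y) (t : pob Phi Y X) :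
  hcomp_beta (pmap Psi f (idm Y) s) (pmap Phi (idm Y) g t)
  = pmap (tamb_comp Psi' Phi') f g (hcomp_beta s t).
Proof. by rewrite /hcomp_beta /= tamb_comp_mapE !tm_nat. Qed.
Fact tambmor_hcomp_str H Z X Y (s : pob Psi Z Y) (t : pob Phi Y X) :
  hcomp_beta (tstr Psi H s) (tstr Phi H t)
  = tstr (tamb_comp Psi' Phi') H (hcomp_beta s t).
Proof. by rewrite /hcomp_beta /= tamb_comp_strE !tm_str. Qed.
Definition tambmor_hcomp : tambmor (tamb_comp Psi Phi) (tamb_comp Psi' Phi') :=
  tlift tambmor_hcomp_bal tambmor_hcomp_nat tambmor_hcomp_str.
Lemma tambmor_hcompE Z X Y (s : pob Psi Z Y) (t : pob Phi Y X) :
  tm tambmor_hcomp (ptens s t) = ptens (tm e s) (tm d t).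
Proof. exact: tliftE. Qed.
End TambHcomp.

Section TambAssoc.
Variables (M N L Q : modcat C).
Variables (Xi : tambara L Q) (Psi : tambara N L) (Phi : tambara M N).
Local Notation XiPsi := (tamb_comp Xi Psi).
Local Notation PsiPhi := (tamb_comp Psi Phi).

Fact assoc_inner_bal Z Y X (t : pob Phi Y X) :
  pbalanced (fun B (r : pob Xi Z B) (s : pob Psi B Y) =>
    ptens r (ptens s t : pob PsiPhi B X)).
Proof.
split=> [B s|B r|B B' h r s].
- exact: ptens_linl.
- by apply: (lin_comp (ptens_linr _)); apply: ptens_linl.
- by rewrite ptens_bal /= tamb_comp_mapE pmap_id.
Qed.
Definition assoc_beta Z X Y (x : pob XiPsi Z Y) (t : pob Phi Y X) :
  pob (tamb_comp Xi PsiPhi) Z X := plift (assoc_inner_bal Z t) x.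
Lemma assoc_betaE Z X Y B (r : pob Xi Z B) (s : pob Psi B Y) (t : pob Phi Y X) :
  assoc_beta (ptens r s) t = ptens r (ptens s t : pob PsiPhi B X).
Proof. by rewrite /assoc_beta pliftE. Qed.
Lemma assoc_beta_linl Z X Y (t : pob Phi Y X) :
  linear (fun x : pob XiPsi Z Y => assoc_beta x t).
Proof. exact: (plift_lin (assoc_inner_bal Z t)). Qed.
Fact assoc_beta_bal Z X : pbalanced (@assoc_beta Z X).
Proof.
split=> [Y t|Y x|Y Y' h x t]; first exact: assoc_beta_linl.
- move=> a t t'; move: x; apply: ptens_ext; first exact: assoc_beta_linl.
    by apply: lin_comb; apply: assoc_beta_linl.
  by move=> B r s; rewrite !assoc_betaE ptens_linr ptens_linr.
- move: x; apply: ptens_ext; last move=> B r s.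
  + by apply: (lin_comp (assoc_beta_linl t)); apply: tamb_comp_lin.
  + exact: assoc_beta_linl.
  by rewrite /= tamb_comp_mapE !assoc_betaE pmap_id ptens_bal.
Qed.
Fact assoc_beta_nat Z Z' X X' (f : hom Z' Z) (g : hom X X') Y
    (x : pob XiPsi Z Y) (t : pob Phi Y X) :
  assoc_beta (pmap XiPsi f (idm Y) x) (pmap Phi (idm Y) g t)
  = pmap (tamb_comp Xi PsiPhi) f g (assoc_beta x t).
Proof.
move: x; apply: ptens_ext; last move=> B r s.
- by apply: (lin_comp (assoc_beta_linl _)); apply: tamb_comp_lin.
- by apply: lin_comp; [exact: tamb_comp_lin|exact: assoc_beta_linl].
by rewrite /= tamb_comp_mapE !assoc_betaE tamb_comp_mapE /= tamb_comp_mapE.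
Qed.
Fact assoc_beta_str H Z X Y (x : pob XiPsi Z Y) (t : pob Phi Y X) :
  assoc_beta (tstr XiPsi H x) (tstr Phi H t)
  = tstr (tamb_comp Xi PsiPhi) H (assoc_beta x t).
Proof.
move: x; apply: ptens_ext; last move=> B r s.
- by apply: (lin_comp (assoc_beta_linl _)); apply: tamb_comp_str_lin.
- by apply: lin_comp; [exact: tamb_comp_str_lin|exact: assoc_beta_linl].
by rewrite /= tamb_comp_strE !assoc_betaE tamb_comp_strE /= tamb_comp_strE.
Qed.
Definition tamb_assoc : tambmor (tamb_comp XiPsi Phi) (tamb_comp Xi PsiPhi) :=
  tlift assoc_beta_bal assoc_beta_nat assoc_beta_str.
Lemma tamb_assocE Z X Y B (r : pob Xi Z B) (s : pob Psi B Y) (t : pob Phi Y X) :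
  tm tamb_assoc (ptens (ptens r s : pob XiPsi Z Y) t)
  = ptens r (ptens s t : pob PsiPhi B X).
Proof. by rewrite tliftE assoc_betaE. Qed.

Fact assocV_inner_bal Z B X (r : pob Xi Z B) :
  pbalanced (fun Y (s : pob Psi B Y) (t : pob Phi Y X) =>
    ptens (ptens r s : pob XiPsi Z Y) t).
Proof.
split=> [Y t|Y s|Y Y' h s t].
- by apply: (lin_comp (ptens_linl _)); apply: ptens_linr.
- exact: ptens_linr.
- by rewrite -ptens_bal /= tamb_comp_mapE pmap_id.
Qed.
Definition assocV_beta Z X B (r : pob Xi Z B) (y : pob PsiPhi B X) :
  pob (tamb_comp XiPsi Phi) Z X := plift (assocV_inner_bal X r) y.
Lemma assocV_betaE Z X Y B (r : pob Xi Z B) (s : pob Psi B Y) (t : pob Phi Y X) :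
  assocV_beta r (ptens s t) = ptens (ptens r s : pob XiPsi Z Y) t.
Proof. by rewrite /assocV_beta pliftE. Qed.
Lemma assocV_beta_linr Z X B (r : pob Xi Z B) :
  linear (fun y : pob PsiPhi B X => assocV_beta r y).
Proof. exact: (plift_lin (assocV_inner_bal X r)). Qed.
Fact assocV_beta_bal Z X : pbalanced (@assocV_beta Z X).
Proof.
split=> [B y|B r|B B' h r y]; last 1 first.
- move: y; apply: ptens_ext; last move=> Y s t.
  + exact: assocV_beta_linr.
  + by apply: (lin_comp (assocV_beta_linr r)); apply: tamb_comp_lin.
  by rewrite /= tamb_comp_mapE !assocV_betaE pmap_id ptens_bal.
- move=> a r r'; move: y; apply: ptens_ext; first exact: assocV_beta_linr.
    by apply: lin_comb; apply: assocV_beta_linr.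
  by move=> Y s t; rewrite !assocV_betaE ptens_linl ptens_linl.
- exact: assocV_beta_linr.
Qed.
Fact assocV_beta_nat Z Z' X X' (f : hom Z' Z) (g : hom X X') B
    (r : pob Xi Z B) (y : pob PsiPhi B X) :
  assocV_beta (pmap Xi f (idm B) r) (pmap PsiPhi (idm B) g y)
  = pmap (tamb_comp XiPsi Phi) f g (assocV_beta r y).
Proof.
move: y; apply: ptens_ext; last move=> Y s t.
- by apply: (lin_comp (assocV_beta_linr _)); apply: tamb_comp_lin.
- by apply: lin_comp; [exact: tamb_comp_lin|exact: assocV_beta_linr].
by rewrite /= tamb_comp_mapE !assocV_betaE tamb_comp_mapE /= tamb_comp_mapE.
Qed.
Fact assocV_beta_str H Z X B (r : pob Xi Z B) (y : pob PsiPhi B X) :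
  assocV_beta (tstr Xi H r) (tstr PsiPhi H y)
  = tstr (tamb_comp XiPsi Phi) H (assocV_beta r y).
Proof.
move: y; apply: ptens_ext; last move=> Y s t.
- by apply: (lin_comp (assocV_beta_linr _)); apply: tamb_comp_str_lin.
- by apply: lin_comp; [exact: tamb_comp_str_lin|exact: assocV_beta_linr].
by rewrite /= tamb_comp_strE !assocV_betaE tamb_comp_strE /= tamb_comp_strE.
Qed.
Definition tamb_assocV : tambmor (tamb_comp Xi PsiPhi) (tamb_comp XiPsi Phi) :=
  tlift assocV_beta_bal assocV_beta_nat assocV_beta_str.
Lemma tamb_assocVE Z X Y B (r : pob Xi Z B) (s : pob Psi B Y) (t : pob Phi Y X) :
  tm tamb_assocV (ptens r (ptens s t : pob PsiPhi B X))
  = ptens (ptens r s : pob XiPsi Z Y) t.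
Proof. by rewrite tliftE assocV_betaE. Qed.

Lemma tambmor_extl (R : tambara M Q)
    (d e : tambmor (tamb_comp XiPsi Phi) R) :
  (forall Z X Y B (r : pob Xi Z B) (s : pob Psi B Y) (t : pob Phi Y X),
     tm d (ptens (ptens r s : pob XiPsi Z Y) t)
     = tm e (ptens (ptens r s : pob XiPsi Z Y) t)) -> d = e.
Proof.
move=> de; apply: tambmor_ext => Z X Y x t; move: x.
exact: (ptens_ext (tm_ptens_linl d t) (tm_ptens_linl e t) (fun B r s => de _ _ _ _ r s t)).
Qed.
Lemma tambmor_extr (R : tambara M Q)
    (d e : tambmor (tamb_comp Xi PsiPhi) R) :
  (forall Z X Y B (r : pob Xi Z B) (s : pob Psi B Y) (t : pob Phi Y X),
     tm d (ptens r (ptens s t : pob PsiPhi B X))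
     = tm e (ptens r (ptens s t : pob PsiPhi B X))) -> d = e.
Proof.
move=> de; apply: tambmor_ext => Z X B r y; move: y.
exact: (ptens_ext (tm_ptens_linr d r) (tm_ptens_linr e r) (fun Y s t => de _ _ _ _ r s t)).
Qed.
End TambAssoc.

Section TambUnits.
Variables (M N : modcat C) (Phi : tambara M N).
Local Notation IdPhi := (tamb_comp (tamb_id N) Phi).
Local Notation PhiId := (tamb_comp Phi (tamb_id M)).

Definition lunit_beta Z X Y (h : pob (tamb_id N) Z Y) (t : pob Phi Y X) :
  pob Phi Z X := pmap Phi (h : hom Z Y) (idm X) t.
Fact lunit_beta_bal Z X : pbalanced (@lunit_beta Z X).
Proof.
split=> [Y t|Y s|Y Y' h s t]; [exact: pmap_linl|exact: pmap_lin|].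
by rewrite /lunit_beta /= /tamb_id_map -pmap_comp compm1 comp1m.
Qed.
Fact lunit_beta_nat Z Z' X X' (f : hom Z' Z) (g : hom X X') Y
    (s : pob (tamb_id N) Z Y) (t : pob Phi Y X) :
  lunit_beta (pmap (tamb_id N) f (idm Y) s) (pmap Phi (idm Y) g t)
  = pmap Phi f g (lunit_beta s t).
Proof. by rewrite /lunit_beta /= /tamb_id_map -!pmap_comp !comp1m compm1. Qed.
Fact lunit_beta_str H Z X Y (s : pob (tamb_id N) Z Y) (t : pob Phi Y X) :
  lunit_beta (tstr (tamb_id N) H s) (tstr Phi H t) = tstr Phi H (lunit_beta s t).
Proof. by rewrite /lunit_beta /= /tamb_id_str tstr_nat fmap_id. Qed.
Definition tamb_lunit : tambmor IdPhi Phi :=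
  tlift lunit_beta_bal lunit_beta_nat lunit_beta_str.
Lemma tamb_lunitE Z X Y (s : hom Z Y) (t : pob Phi Y X) :
  tm tamb_lunit (ptens (s : pob (tamb_id N) Z Y) t) = pmap Phi s (idm X) t.
Proof. exact: tliftE. Qed.

Definition lunitV_fun Z X (p : pob Phi Z X) : pob IdPhi Z X :=
  ptens (idm Z : pob (tamb_id N) Z Z) p.
Fact lunitV_lin Z X : linear (@lunitV_fun Z X).
Proof. exact: ptens_linr. Qed.
Fact lunitV_nat Z Z' X X' (f : hom Z' Z) (g : hom X X') (p : pob Phi Z X) :
  lunitV_fun (pmap Phi f g p) = pmap IdPhi f g (lunitV_fun p).
Proof.
rewrite /lunitV_fun /= tamb_comp_mapE pmap_split -ptens_bal /= /tamb_id_map.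
by rewrite !comp1m !compm1.
Qed.
Fact lunitV_str H Z X (p : pob Phi Z X) :
  lunitV_fun (tstr Phi H p) = tstr IdPhi H (lunitV_fun p).
Proof. by rewrite /lunitV_fun /= tamb_comp_strE /= /tamb_id_str fmap_id. Qed.
Definition tamb_lunitV : tambmor Phi IdPhi :=
  TambMor lunitV_lin lunitV_nat lunitV_str.

Definition runit_beta Z X Y (t : pob Phi Z Y) (h : pob (tamb_id M) Y X) :
  pob Phi Z X := pmap Phi (idm Z) (h : hom Y X) t.
Fact runit_beta_bal Z X : pbalanced (@runit_beta Z X).
Proof.
split=> [Y t|Y s|Y Y' h s t]; [exact: pmap_lin|exact: pmap_linr|].
by rewrite /runit_beta /= /tamb_id_map -pmap_comp !comp1m.
Qed.
Fact runit_beta_nat Z Z' X X' (f : hom Z' Z) (g : hom X X') Y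
    (s : pob Phi Z Y) (t : pob (tamb_id M) Y X) :
  runit_beta (pmap Phi f (idm Y) s) (pmap (tamb_id M) (idm Y) g t)
  = pmap Phi f g (runit_beta s t).
Proof. by rewrite /runit_beta /= /tamb_id_map -!pmap_comp !compm1 comp1m. Qed.
Fact runit_beta_str H Z X Y (s : pob Phi Z Y) (t : pob (tamb_id M) Y X) :
  runit_beta (tstr Phi H s) (tstr (tamb_id M) H t) = tstr Phi H (runit_beta s t).
Proof. by rewrite /runit_beta /= /tamb_id_str tstr_nat fmap_id. Qed.
Definition tamb_runit : tambmor PhiId Phi :=
  tlift runit_beta_bal runit_beta_nat runit_beta_str.
Lemma tamb_runitE Z X Y (s : pob Phi Z Y) (t : hom Y X) :
  tm tamb_runit (ptens s (t : pob (tamb_id M) Y X)) = pmap Phi (idm Z) t s.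
Proof. exact: tliftE. Qed.

Definition runitV_fun Z X (p : pob Phi Z X) : pob PhiId Z X :=
  ptens p (idm X : pob (tamb_id M) X X).
Fact runitV_lin Z X : linear (@runitV_fun Z X).
Proof. exact: ptens_linl. Qed.
Fact runitV_nat Z Z' X X' (f : hom Z' Z) (g : hom X X') (p : pob Phi Z X) :
  runitV_fun (pmap Phi f g p) = pmap PhiId f g (runitV_fun p).
Proof.
rewrite /runitV_fun /= tamb_comp_mapE.
have -> : pmap Phi f g p = pmap Phi (idm Z') g (pmap Phi f (idm X) p).
  by rewrite -pmap_comp !compm1.
by rewrite ptens_bal /= /tamb_id_map !compm1 comp1m.
Qed.
Fact runitV_str H Z X (p : pob Phi Z X) :
  runitV_fun (tstr Phi H p) = tstr PhiId H (runitV_fun p).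
Proof. by rewrite /runitV_fun /= tamb_comp_strE /= /tamb_id_str fmap_id. Qed.
Definition tamb_runitV : tambmor Phi PhiId :=
  TambMor runitV_lin runitV_nat runitV_str.
End TambUnits.

Definition CTamb : bicategory K (modcat C).
Proof.
refine (@Bicategory K (modcat C)
  (@tambara K C) (fun M N P Q => tambmor P Q : lmodType K)
  tambmor_id tambmor_vcomp tamb_id tamb_comp tambmor_hcomp
  tamb_assoc tamb_assocV tamb_lunit tamb_lunitV tamb_runit tamb_runitV
  _ _ _ _ _ _ _ _ _ _ _ _ _ _ _ _ _ _ _ _).
- move=> M N P Q R d a e e'; apply: tambmor_eq => Y X p.
  by rewrite tambmor_combE !tambmor_vcompE tambmor_combE.
- move=> M N P Q R e a d d'; apply: tambmor_eq => Y X p.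
  by rewrite tambmor_combE !tambmor_vcompE tambmor_combE tm_lin.
- by move=> *; apply: tambmor_eq.
- by move=> *; apply: tambmor_eq.
- by move=> *; apply: tambmor_eq.
- move=> M N L Psi Psi' Phi Phi' d a e e'; apply: tambmor_ext => Z X Y s t.
  by rewrite tambmor_combE !tambmor_hcompE tambmor_combE ptens_linl.
- move=> M N L Psi Psi' Phi Phi' e a d d'; apply: tambmor_ext => Z X Y s t.
  by rewrite tambmor_combE !tambmor_hcompE tambmor_combE ptens_linr.
- by move=> *; apply: tambmor_ext => Z X Y s t; rewrite tambmor_hcompE.
- move=> *; apply: tambmor_ext => Z X Y s t.
  by rewrite tambmor_vcompE !tambmor_hcompE.
- move=> *; apply: tambmor_extl => Z X Y B r s t.
  by rewrite tambmor_vcompE tamb_assocE tamb_assocVE.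
- move=> *; apply: tambmor_extr => Z X Y B r s t.
  by rewrite tambmor_vcompE tamb_assocVE tamb_assocE.
- move=> M N P; apply: tambmor_ext => Z X Y s t.
  rewrite tambmor_vcompE tamb_lunitE /= /lunitV_fun -ptens_bal /= /tamb_id_map.
  by rewrite !compm1.
- move=> M N P; apply: tambmor_eq => Z X p.
  by rewrite tambmor_vcompE tamb_lunitE pmap_id.
- move=> M N P; apply: tambmor_ext => Z X Y s t.
  rewrite tambmor_vcompE tamb_runitE /= /runitV_fun ptens_bal /= /tamb_id_map.
  by rewrite !comp1m.
- move=> M N P; apply: tambmor_eq => Z X p.
  by rewrite tambmor_vcompE tamb_runitE pmap_id.
- move=> *; apply: tambmor_extl => Z X Y B r s t.
  by rewrite !tambmor_vcompE tamb_assocE !tambmor_hcompE tamb_assocE.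
- move=> M N P P' x; apply: tambmor_ext => Z X Y s t.
  by rewrite !tambmor_vcompE !tambmor_hcompE !tamb_lunitE tm_nat.
- move=> M N P P' x; apply: tambmor_ext => Z X Y s t.
  by rewrite !tambmor_vcompE !tambmor_hcompE !tamb_runitE tm_nat.
- move=> M N L Q R k h g f; apply: tambmor_extl => Z X Y B x s t; move: x.
  apply: ptens_ext => [||A q r].
  + by move=> a x x'; rewrite !ptens_linl [LHS]tm_lin.
  + by move=> a x x'; rewrite !ptens_linl [LHS]tm_lin.
  rewrite !tambmor_vcompE !tambmor_hcompE !tamb_assocE.
  by rewrite tambmor_hcompE tamb_assocE.
- move=> M N L g f; apply: tambmor_extl => Z X Y B r s t.
  by rewrite !tambmor_vcompE tamb_assocE !tambmor_hcompE tamb_lunitE tamb_runitE ptens_bal.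
Defined.

End TambBicategory.

Section Pseudofunctor.
Variables (K : fieldType) (C : moncat K).

Section OnModFun.
Variables (M N : modcat C) (Phi : modfun M N).
Definition P_map (Z Z' : N) (X X' : M) (f : hom Z' Z) (g : hom X X')
    (p : hom Z (Phi X)) : hom Z' (Phi X') := fmap Phi g ∘ p ∘ f.
Definition P_str (F : C) (Z : N) (X : M) (p : hom Z (Phi X)) :
    hom (act N F Z) (Phi (act M F X)) := mf_str Phi F X ∘ fmap (act N F) p.
Fact P_map_lin Z Z' X X' (f : hom Z' Z) (g : hom X X') : linear (P_map f g).
Proof.
by apply: (@lin_comp _ _ _ _ (fun p => p ∘ f)); [apply: comp_linl|apply: comp_linr].
Qed.
Fact P_map_linl Z Z' X X' (g : hom X X') (p : hom Z (Phi X)) :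
  linear (fun f : hom Z' Z => P_map f g p).
Proof. exact: comp_linr. Qed.
Fact P_map_linr Z Z' X X' (f : hom Z' Z) (p : hom Z (Phi X)) :
  linear (fun g : hom X X' => P_map f g p).
Proof.
apply: (@lin_comp _ _ _ _ (fun p => p ∘ f)); first exact: comp_linl.
by apply: (@lin_comp _ _ _ _ (fun q => q ∘ p)); [exact: comp_linl|exact: fmap_lin].
Qed.
Fact P_map_id Z X (p : hom Z (Phi X)) : P_map (idm Z) (idm X) p = p.
Proof. by rewrite /P_map fmap_id comp1m compm1. Qed.
Fact P_map_comp Z Z' Z'' X X' X'' (f' : hom Z'' Z') (f : hom Z' Z)
    (g' : hom X' X'') (g : hom X X') (p : hom Z (Phi X)) :
  P_map (f ∘ f') (g' ∘ g) p = P_map f' g' (P_map f g p).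
Proof. by rewrite /P_map fmap_comp !compA. Qed.
Fact P_str_lin F Z X : linear (@P_str F Z X).
Proof. by apply: lin_comp; [exact: comp_linr|exact: fmap_lin]. Qed.
Fact P_str_nat F Z Z' X X' (f : hom Z' Z) (g : hom X X') (p : hom Z (Phi X)) :
  P_str F (P_map f g p) = P_map (fmap (act N F) f) (fmap (act M F) g) (P_str F p).
Proof. by rewrite /P_str /P_map !fmap_comp !compA mf_nat. Qed.
Fact P_extranat (F G : C) (h : hom F G) Z X (p : hom Z (Phi X)) :
  P_map (idm (act N F Z)) (actm h X) (P_str F p)
  = P_map (actm h Z) (idm (act M G X)) (P_str G p).
Proof.
rewrite /P_str /P_map fmap_id compm1 comp1m compA -mf_natl.
by rewrite -!compA actm_nat.
Qed.
Fact P_mul G F Z X (p : hom Z (Phi X)) :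
  P_map (actM G F Z) (idm (act M (tens G F) X)) (P_str (tens G F) p)
  = P_map (idm (act N G (act N F Z))) (actM G F X) (P_str G (P_str F p)).
Proof.
rewrite /P_str /P_map fmap_id compm1 comp1m -compA -actM_nat compA mf_mul.
by rewrite fmap_comp !compA.
Qed.
Fact P_unit Z X (p : hom Z (Phi X)) :
  P_map (act1 Z) (act1V X) (P_str mon1 p) = p.
Proof.
rewrite /P_str /P_map -compA -(compA _ _ (act1 Z)) -act1_nat (compA _ _ p) mf_unit.
rewrite compA -fmap_comp; case: (act1_inv X) => -> _.
by rewrite fmap_id comp1m.
Qed.
Definition P_modfun : tambara M N :=
  @Tambara K C M N (fun Z X => hom Z (Phi X)) P_map P_map_lin P_map_linl P_map_linr
    P_map_id P_map_comp P_str P_str_lin P_str_nat P_extranat P_mul P_unit.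
End OnModFun.

Section OnModTrans.
Variables (M N : modcat C) (Phi Psi : modfun M N) (d : modtrans Phi Psi).
Definition P_trans_fun (Z : N) (X : M) (p : pob (P_modfun Phi) Z X) :
  pob (P_modfun Psi) Z X := d X ∘ (p : hom Z (Phi X)).
Fact P_trans_lin Z X : linear (@P_trans_fun Z X).
Proof. exact: comp_linr. Qed.
Fact P_trans_nat Z Z' X X' (f : hom Z' Z) (g : hom X X') (p : pob (P_modfun Phi) Z X) :
  P_trans_fun (pmap (P_modfun Phi) f g p) = pmap (P_modfun Psi) f g (P_trans_fun p).
Proof. by rewrite /P_trans_fun /= /P_map !compA mt_nat. Qed.
Fact P_trans_str F Z X (p : pob (P_modfun Phi) Z X) :
  P_trans_fun (tstr (P_modfun Phi) F p) = tstr (P_modfun Psi) F (P_trans_fun p).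
Proof. by rewrite /P_trans_fun /= /P_str fmap_comp !compA mt_str. Qed.
Definition P_modtrans : tambmor (P_modfun Phi) (P_modfun Psi) :=
  TambMor P_trans_lin P_trans_nat P_trans_str.
End OnModTrans.

Section Compositor.
Variables (M N L : modcat C) (Psi : modfun N L) (Phi : modfun M N).
Local Notation PP := (tamb_comp (P_modfun Psi) (P_modfun Phi)).
Local Notation PC := (P_modfun (modfun_comp Psi Phi)).

Definition P_comp_beta Z X Y (s : pob (P_modfun Psi) Z Y) (t : pob (P_modfun Phi) Y X) :
  pob PC Z X := fmap Psi (t : hom Y (Phi X)) ∘ (s : hom Z (Psi Y)).
Fact P_comp_bal Z X : pbalanced (@P_comp_beta Z X).
Proof.
split=> [Y t|Y s|Y Y' h s t]; first exact: comp_linr.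
- by apply: (@lin_comp _ _ _ _ (fun q => q ∘ s)); [exact: comp_linl|exact: fmap_lin].
- by rewrite /P_comp_beta /= /P_map fmap_id comp1m compm1 fmap_comp compA.
Qed.
Fact P_comp_nat Z Z' X X' (f : hom Z' Z) (g : hom X X') Y
    (s : pob (P_modfun Psi) Z Y) (t : pob (P_modfun Phi) Y X) :
  P_comp_beta (pmap (P_modfun Psi) f (idm Y) s) (pmap (P_modfun Phi) (idm Y) g t)
  = pmap PC f g (P_comp_beta s t).
Proof.
by rewrite /P_comp_beta /= /P_map fmap_id comp1m compm1 fmap_comp !compA.
Qed.
Fact P_comp_str H Z X Y (s : pob (P_modfun Psi) Z Y) (t : pob (P_modfun Phi) Y X) :
  P_comp_beta (tstr (P_modfun Psi) H s) (tstr (P_modfun Phi) H t)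
  = tstr PC H (P_comp_beta s t).
Proof.
rewrite /P_comp_beta /= /P_str /= /modfun_comp_str !fmap_comp -!compA.
by congr (_ ∘ _); rewrite !compA mf_nat.
Qed.
Definition P_comp : tambmor PP PC := tlift P_comp_bal P_comp_nat P_comp_str.
Lemma P_compE Z X Y (s : hom Z (Psi Y)) (t : hom Y (Phi X)) :
  tm P_comp (ptens (s : pob (P_modfun Psi) Z Y) (t : pob (P_modfun Phi) Y X))
  = fmap Psi t ∘ s.
Proof. exact: tliftE. Qed.

Definition P_compV_fun Z X (p : pob PC Z X) : pob PP Z X :=
  ptens (p : pob (P_modfun Psi) Z (Phi X)) (idm (Phi X) : pob (P_modfun Phi) (Phi X) X).
Fact P_compV_lin Z X : linear (@P_compV_fun Z X).
Proof.
move=> a p q; exact: (@ptens_linl _ _ _ _ _ (P_modfun Psi) (P_modfun Phi) Z X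
  (Phi X) (idm (Phi X)) a p q).
Qed.
Fact P_compV_compE Z X Y (s : hom Z (Psi Y)) (t : hom Y (Phi X)) :
  P_compV_fun (fmap Psi t ∘ s : pob PC Z X)
  = ptens (s : pob (P_modfun Psi) Z Y) (t : pob (P_modfun Phi) Y X).
Proof.
rewrite /P_compV_fun.
have -> : (fmap Psi t ∘ s : pob (P_modfun Psi) Z (Phi X))
        = pmap (P_modfun Psi) (idm Z) t s by rewrite /= /P_map compm1.
have e : pmap (P_modfun Phi) t (idm X) (idm (Phi X) : pob (P_modfun Phi) (Phi X) X) = t.
  by rewrite /= /P_map fmap_id !comp1m.
by rewrite ptens_bal e.
Qed.
Fact P_compVK Z X (x : pob PP Z X) : P_compV_fun (tm P_comp x) = x.
Proof.
move: x; apply: ptens_ext; last move=> Y s t.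
- exact: (lin_comp (@P_compV_lin Z X) (@tm_lin _ _ _ _ _ _ P_comp Z X)).
- exact: lin_id.
by rewrite P_compE P_compV_compE.
Qed.
Fact P_compK Z X (p : pob PC Z X) : tm P_comp (P_compV_fun p) = p.
Proof. by rewrite P_compE fmap_id comp1m. Qed.
Fact P_compV_nat Z Z' X X' (f : hom Z' Z) (g : hom X X') (p : pob PC Z X) :
  P_compV_fun (pmap PC f g p) = pmap PP f g (P_compV_fun p).
Proof. by rewrite -[RHS]P_compVK tm_nat P_compK. Qed.
Fact P_compV_str H Z X (p : pob PC Z X) :
  P_compV_fun (tstr PC H p) = tstr PP H (P_compV_fun p).
Proof. by rewrite -[RHS]P_compVK tm_str P_compK. Qed.
Definition P_compV : tambmor PC PP := TambMor P_compV_lin P_compV_nat P_compV_str.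
End Compositor.

(* The Hom-profunctor and P(id) agree up to composition with the identity      *)
(* structure maps of the identity module functor.                              *)
Section Unitor.
Variable M : modcat C.
Local Notation PI := (P_modfun (modfun_id M)).
Fact P_id_nat (Y Y' X X' : M) (f : hom Y' Y) (g : hom X X') (p : hom Y X) :
  pmap (tamb_id M) f g p = pmap PI f g p.
Proof. by []. Qed.
Fact P_id_str H (Y X : M) (p : hom Y X) : tstr (tamb_id M) H p = tstr PI H p.
Proof. by rewrite /= /P_str /= comp1m. Qed.
Definition P_id : tambmor (tamb_id M) PI :=
  @TambMor K C M M (tamb_id M) PI (fun Y X p => p) (fun Y X => @lin_id K (hom Y X))
    P_id_nat P_id_str.
Definition P_idV : tambmor PI (tamb_id M) :=
  @TambMor K C M M PI (tamb_id M) (fun Y X p => p) (fun Y X => @lin_id K (hom Y X))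
    (fun Y Y' X X' f g p => esym (P_id_nat f g p))
    (fun H Y X p => esym (P_id_str H p)).
End Unitor.

Definition PTamb : pseudofunctor (CMod C) (CTamb C).
Proof.
refine (@PseudoFunctor K (modcat C) (modcat C) (CMod C) (CTamb C)
  (fun M => M) P_modfun P_modtrans P_comp P_id _ _ _ _ _ _ _ _ _).
- move=> M N Phi Psi a d d'; apply: tambmor_eq => Z X p.
  by rewrite tambmor_combE /= /P_trans_fun [X in X ∘ _]modtrans_combE comp_linl.
- by move=> M N Phi; apply: tambmor_eq => Z X p; rewrite /= /P_trans_fun /= comp1m.
- by move=> M N Phi Psi Xi e d; apply: tambmor_eq => Z X p;
    rewrite /= /P_trans_fun /= compA.
- move=> M N L Psi Phi; exists (P_compV Psi Phi); split; apply: tambmor_eq => Z X p.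
    exact: P_compVK.
  exact: P_compK.
- by move=> M; exists (P_idV M); split; apply: tambmor_eq.
- move=> M N L Psi Psi' Phi Phi' e d; apply: tambmor_ext => Z X Y s t.
  rewrite !tambmor_vcompE tambmor_hcompE P_compE P_compE /= /P_trans_fun /=.
  by rewrite /modtrans_hcomp_fun fmap_comp -!compA; congr (_ ∘ _);
    rewrite !compA mt_nat.
- move=> M N L Q h g f; apply: tambmor_extl => Z X Y B r s t.
  rewrite !tambmor_vcompE tambmor_hcompE tamb_assocE tambmor_hcompE.
  by rewrite !P_compE /= /P_trans_fun /= comp1m fmap_comp compA.
- move=> M N f; apply: tambmor_ext => Z X Y s t.
  rewrite !tambmor_vcompE tambmor_hcompE tamb_lunitE P_compE.
  by rewrite /= /P_trans_fun /P_map /= comp1m fmap_id comp1m.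
- move=> M N f; apply: tambmor_ext => Z X Y s t.
  rewrite !tambmor_vcompE tambmor_hcompE tamb_runitE P_compE.
  by rewrite /= /P_trans_fun /P_map /= comp1m compm1.
Defined.

End Pseudofunctor.

Definition representable (K : fieldType) (C : moncat K) (M N : modcat C)
    (P : hom1 (CTamb C) M N) : Prop :=
  exists Phi : hom1 (CMod C) M N, isomorphic1 P (ps1 (PTamb C) Phi).

(* Main.v *)
From mathcomp Require Import all_boot all_algebra.
From mathcomp Require Import boolp.
Require Import Defs.

(** By the Yoneda lemma a Tambara morphism y : <-,Phi-> -> <-,Psi-> is
postcomposition with d_X = y(id_(Phi X)); naturality and compatibility of y
with the Tambara structures, evaluated at identities, say precisely that d is
a module transformation ([P_modtrans_surj]).  Hence the pseudofunctor is
locally full and faithful.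

For a module functor Phi, the Tambara module <-,Phi-> is left adjoint to
<Phi-,->, whose Tambara structure sends q to NF(q) composed with the inverse of
phi_F.  The unit sends f : X' -> X to the class of id (x) Phi f, the counit is
composition.  The adjunction is written for any P isomorphic to <-,Phi->
([corep_adjunction]): replacing the Yoneda element id_(Phi X) by its image
under the isomorphism costs nothing, and the passage to an isomorphic
1-morphism needs no separate argument.

Conversely let P have the right adjoint Q, with unit eta and counit eps.
Since N is additive, the element eta(id_X) of the coend (Q P)(X,X), a priori a
finite sum of tensors, is a single tensor v (x) u with u in P(Y,X) and v in
Q(X,Y) ([ptens_pure]).  One triangle identity says that every p in P(Z,X) is
the restriction of u along eps(p (x) v) : Z -> Y.  For p = u this makes
eps(u (x) v) idempotent, and splitting it lets one assume eps(u (x) v) = id_Y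
([dual_pair_exists]).  Then u is universal: p is the restriction of u along a
unique morphism Z -> Y, so Y represents P(-,X).  The equations
eta(id_X) = v (x) u and eps(u (x) v) = id_Y are preserved by the Tambara
structures, because eta and eps are Tambara morphisms; hence t_F(u) is again
universal.  Universality of the chosen elements u_X makes X |-> Y_X a functor,
and the universality of t_F(u_X) says that the comparison N F Y_X -> Y_(M F X)
is invertible, so that this functor is a module functor representing P
([representable_if_universal]). *)

Set Implicit Arguments.
Unset Strict Implicit.
Unset Printing Implicit Defensive.

Import GRing.Theory.
Local Open Scope ring_scope.
Local Open Scope cat_scope.

(** * Universal elements and representability *)

Section UniversalElements.
Variables (K : fieldType) (C : moncat K) (M N : modcat C).

Lemma pmap_compl (P : tambara M N) Z Z' Z'' X (f : hom Z' Z) (f' : hom Z'' Z') (p : pob P Z X) :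
  pmap P (f ∘ f') (idm X) p = pmap P f' (idm X) (pmap P f (idm X) p).
Proof. by rewrite -pmap_comp comp1m. Qed.

Lemma pmap_swap (P : tambara M N) Z Z' X X' (f : hom Z' Z) (g : hom X X') (p : pob P Z X) :
  pmap P f (idm X') (pmap P (idm Z) g p) = pmap P (idm Z') g (pmap P f (idm X) p).
Proof. by rewrite -!pmap_comp !comp1m !compm1. Qed.

Lemma tstr_pmapl (P : tambara M N) F Z Z' X (f : hom Z' Z) (p : pob P Z X) :
  tstr P F (pmap P f (idm X) p)
  = pmap P (fmap (act N F) f) (idm (act M F X)) (tstr P F p).
Proof. by rewrite tstr_nat fmap_id. Qed.

(** A universal element u of P(-,X) exhibits Y as an object representing
P(-,X). *)
Definition universal (P : tambara M N) Y X (u : pob P Y X) : Prop :=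
  forall Z (p : pob P Z X), exists! h : hom Z Y, pmap P h (idm X) u = p.

Lemma universal_inj (P : tambara M N) Y X (u : pob P Y X) Z (h h' : hom Z Y) :
  universal u -> pmap P h (idm X) u = pmap P h' (idm X) u -> h = h'.
Proof.
move=> uu e; have [k [_ kuniq]] := uu Z (pmap P h' (idm X) u).
by rewrite -(kuniq h) // -(kuniq h').
Qed.

Lemma universal_iso (P : tambara M N) X Y Y' (u : pob P Y X) (u' : pob P Y' X)
    (h : hom Y Y') :
  universal u -> universal u' -> pmap P h (idm X) u' = u -> is_iso h.
Proof.
move=> uu uu' hu; have [k [ku _]] := uu Y' u'.
exists k; split.
- apply: (universal_inj uu).
  by rewrite -{1}(comp1m (idm X)) pmap_comp ku hu pmap_id.
- apply: (universal_inj uu').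
  by rewrite -{1}(comp1m (idm X)) pmap_comp hu ku pmap_id.
Qed.

(** A choice of universal elements makes X |-> Y X a functor.  It is a module
functor only because the Tambara structure preserves the chosen elements: in
general the comparison map [rep_str] is not invertible. *)
Section Representation.
Variables (P : tambara M N) (Y : M -> N) (u : forall X, pob P (Y X) X).
Hypothesis uU : forall X, universal (u X).
Hypothesis tuU : forall F X, universal (tstr P F (u X)).

Definition classify Z X (p : pob P Z X) : hom Z (Y X) := sval (cid (uU p)).

Lemma classifyE Z X (p : pob P Z X) : pmap P (classify p) (idm X) (u X) = p.
Proof. by rewrite /classify; case: cid => h []. Qed.

Lemma classify_pmap Z X (h : hom Z (Y X)) :
  classify (pmap P h (idm X) (u X)) = h.
Proof. by apply: (universal_inj (@uU X)); rewrite classifyE. Qed.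

Definition rep_map X X' (f : hom X X') : hom (Y X) (Y X') :=
  classify (pmap P (idm (Y X)) f (u X)).

Lemma rep_mapE X X' (f : hom X X') :
  pmap P (rep_map f) (idm X') (u X') = pmap P (idm (Y X)) f (u X).
Proof. exact: classifyE. Qed.

Fact rep_map_lin X X' : linear (@rep_map X X').
Proof.
move=> a f g; apply: (universal_inj (@uU X')).
by rewrite pmap_linl !rep_mapE pmap_linr.
Qed.
Fact rep_map_id X : rep_map (idm X) = idm (Y X).
Proof. by apply: (universal_inj (@uU X)); rewrite rep_mapE. Qed.
Fact rep_map_comp X X' X'' (g : hom X' X'') (f : hom X X') :
  rep_map (g ∘ f) = rep_map g ∘ rep_map f.
Proof.
apply: (universal_inj (@uU X'')).
by rewrite pmap_compl !rep_mapE pmap_swap rep_mapE -pmap_comp comp1m.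
Qed.
Definition rep_functor : linfunctor M N :=
  LinFunctor rep_map_lin rep_map_id rep_map_comp.

Definition rep_str F X : hom (act N F (Y X)) (Y (act M F X)) :=
  classify (tstr P F (u X)).

Lemma rep_strE F X :
  pmap P (rep_str F X) (idm (act M F X)) (u (act M F X)) = tstr P F (u X).
Proof. exact: classifyE. Qed.

Fact rep_str_iso F X : is_iso (rep_str F X).
Proof.
exact: (universal_iso (@tuU F X) (@uU (act M F X)) (rep_strE F X)).
Qed.
Fact rep_str_nat F (X X' : M) (f : hom X X') :
  rep_str F X' ∘ fmap (act N F) (rep_map f)
  = rep_map (fmap (act M F) f) ∘ rep_str F X.
Proof.
apply: (universal_inj (@uU _)).
rewrite !pmap_compl rep_strE -tstr_pmapl rep_mapE tstr_nat fmap_id.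
by rewrite rep_mapE pmap_swap rep_strE.
Qed.
Fact rep_str_natl (F G : C) (h : hom F G) X :
  rep_str G X ∘ actm h (Y X) = rep_map (actm h X) ∘ rep_str F X.
Proof.
apply: (universal_inj (@uU _)).
by rewrite !pmap_compl rep_strE -tstr_extranat rep_mapE pmap_swap rep_strE.
Qed.
Fact rep_str_mul G F X :
  rep_str (tens G F) X ∘ actM G F (Y X)
  = rep_map (actM G F X) ∘ (rep_str G (act M F X) ∘ fmap (act N G) (rep_str F X)).
Proof.
apply: (universal_inj (@uU _)).
rewrite !pmap_compl rep_strE tstr_mul rep_mapE !pmap_swap rep_strE.
by rewrite -tstr_pmapl rep_strE.
Qed.
(** The unit axiom of P writes u as t_1(u) restricted along act1 and extended
along act1V; extending further along act1 cancels act1V. *)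
Fact rep_str_unit X : rep_str mon1 X ∘ act1 (Y X) = rep_map (act1 X).
Proof.
apply: (universal_inj (@uU _)).
rewrite pmap_compl rep_strE rep_mapE -[in RHS](tstr_unit (u X)) -pmap_comp compm1.
by case: (act1_inv X) => _ ->.
Qed.
Definition rep_modfun : modfun M N :=
  @ModFun K C M N rep_functor rep_str rep_str_iso rep_str_nat rep_str_natl
    rep_str_mul rep_str_unit.

Definition rep_eval Z X (h : pob (P_modfun rep_modfun) Z X) : pob P Z X :=
  pmap P (h : hom Z (Y X)) (idm X) (u X).
Fact rep_eval_lin Z X : linear (@rep_eval Z X).
Proof. exact: pmap_linl. Qed.
Fact rep_eval_nat Z Z' X X' (f : hom Z' Z) (g : hom X X')
    (h : pob (P_modfun rep_modfun) Z X) :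
  rep_eval (pmap (P_modfun rep_modfun) f g h) = pmap P f g (rep_eval h).
Proof.
rewrite /rep_eval /= /P_map !pmap_compl rep_mapE pmap_swap -!pmap_comp.
by rewrite !comp1m !compm1.
Qed.
Fact rep_eval_str H Z X (h : pob (P_modfun rep_modfun) Z X) :
  rep_eval (tstr (P_modfun rep_modfun) H h) = tstr P H (rep_eval h).
Proof. by rewrite /rep_eval /= /P_str pmap_compl rep_strE -tstr_pmapl. Qed.
Definition rep_eval_mor : tambmor (P_modfun rep_modfun) P :=
  TambMor rep_eval_lin rep_eval_nat rep_eval_str.

Lemma rep_eval_inj Z X : injective (@rep_eval Z X).
Proof. by move=> h h'; apply: universal_inj. Qed.

Fact classify_lin Z X :
  linear (fun p : pob P Z X => classify p : pob (P_modfun rep_modfun) Z X).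
Proof. by move=> a p q; apply: rep_eval_inj; rewrite rep_eval_lin /rep_eval !classifyE. Qed.
Fact classify_nat Z Z' X X' (f : hom Z' Z) (g : hom X X') (p : pob P Z X) :
  classify (pmap P f g p)
  = pmap (P_modfun rep_modfun) f g (classify p : pob (P_modfun rep_modfun) Z X).
Proof. by apply: rep_eval_inj; rewrite rep_eval_nat /rep_eval !classifyE. Qed.
Fact classify_str H Z X (p : pob P Z X) :
  classify (tstr P H p)
  = tstr (P_modfun rep_modfun) H (classify p : pob (P_modfun rep_modfun) Z X).
Proof. by apply: rep_eval_inj; rewrite rep_eval_str /rep_eval !classifyE. Qed.
Definition classify_mor : tambmor P (P_modfun rep_modfun) :=
  @TambMor K C M N P (P_modfun rep_modfun) (fun Z X p => classify p)
    classify_lin classify_nat classify_str.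

Lemma rep_modfun_represents : representable (P : hom1 (CTamb C) M N).
Proof.
exists rep_modfun, classify_mor, rep_eval_mor; split; apply: tambmor_eq => Z X p.
- exact: classifyE.
- exact: classify_pmap.
Qed.
End Representation.

Lemma representable_if_universal (P : tambara M N) :
  (forall X, exists Y (u : pob P Y X),
     universal u /\ forall F, universal (tstr P F u)) ->
  representable (P : hom1 (CTamb C) M N).
Proof.
move=> H.
pose w X := cid (H X); pose v X := cid (svalP (w X)).
have vP X := svalP (v X).
apply: (@rep_modfun_represents P (fun X => sval (w X)) (fun X => sval (v X))).
- by move=> X; case: (vP X).
- by move=> F X; case: (vP X) => _; apply.
Qed.
End UniversalElements.

(** * Tensors over an additive category *)

Section AdditiveCoend.
Variables (K : fieldType) (C : moncat K) (M N L : modcat C).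
Variables (Psi : tambara N L) (Phi : tambara M N).

(** Pushing both left factors into the biproduct and pulling both right factors
back from it, the cross terms vanish by balancing since p1 i2 = p2 i1 = 0. *)
Lemma ptens_pair Z X (Y1 Y2 Y : N) (s1 : pob Psi Z Y1) (t1 : pob Phi Y1 X)
    (s2 : pob Psi Z Y2) (t2 : pob Phi Y2 X) :
  biproduct Y1 Y2 Y ->
  exists (s : pob Psi Z Y) (t : pob Phi Y X), ptens s1 t1 + ptens s2 t2 = ptens s t.
Proof.
move=> [i1 [i2 [p1 [p2 [p1i1 p2i2 p1i2 p2i1 _]]]]].
exists (pmap Psi (idm Z) i1 s1 + pmap Psi (idm Z) i2 s2),
       (pmap Phi p1 (idm X) t1 + pmap Phi p2 (idm X) t2).
rewrite (linD (ptens_linl _)) !ptens_bal !(linD (pmap_lin _ _)) -!pmap_comp comp1m.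
rewrite p1i1 p2i2 p1i2 p2i1 !(lin0 (pmap_linl _ _)) !pmap_id.
by rewrite addr0 add0r.
Qed.

Lemma ptens_pure Z X (x : tamb_comp_ob Psi Phi Z X) :
  additive_cat N ->
  exists (Y : N) (s : pob Psi Z Y) (t : pob Phi Y X), x = ptens s t.
Proof.
move=> [[z _] bip]; rewrite (coend_sum x).
elim: (generic_quotient.repr x) => [|y r [Y2 [s2 [t2 IH]]]].
  (* The empty sum is 0 (x) 0 over any object; z only serves as one. *)
  by exists z, 0, 0; rewrite big_nil (lin0 (ptens_linl _)).
rewrite big_cons IH; have [Y bY] := bip (tag y) Y2.
have [s [t st]] := ptens_pair (tagged y).1 (tagged y).2 s2 t2 bY.
by exists Y, s, t.
Qed.
End AdditiveCoend.

(** * From a right adjoint to universal elements *)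

Section DualPairs.
Variables (K : fieldType) (C : moncat K) (M N : modcat C).
Variables (P : tambara M N) (Q : tambara N M).
Variables (eta : tambmor (tamb_id M) (tamb_comp Q P))
          (eps : tambmor (tamb_comp P Q) (tamb_id N)).
Hypothesis adj : @is_adjunction K _ (CTamb C) M N P Q eta eps.

Local Notation ev p q := (tm eps (ptens p q) : hom _ _).

Definition unit_at X (Y : N) (v : pob Q X Y) (u : pob P Y X) : Prop :=
  tm eta (idm X : pob (tamb_id M) X X) = ptens v u.

(** The first triangle identity, evaluated at p. *)
Lemma unit_at_triangle X Y (v : pob Q X Y) (u : pob P Y X) Z (p : pob P Z X) :
  unit_at v u -> pmap P (ev p v) (idm X) u = p.
Proof.
have tri : tm (tamb_lunit P) (tm (tambmor_hcomp eps (tambmor_id P))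
    (tm (tamb_assocV P Q P) (tm (tambmor_hcomp (tambmor_id P) eta)
      (ptens p (idm X : pob (tamb_id M) X X))))) = p.
  by case: adj => /(congr1 (fun d : tambmor P P => tm d p)) h _; exact: h.
by move=> uv; rewrite -[RHS]tri tambmor_hcompE uv tamb_assocVE tambmor_hcompE tamb_lunitE.
Qed.

Lemma ev_pmap Z Z' X Y (f : hom Z' Z) (p : pob P Z X) (v : pob Q X Y) :
  ev (pmap P f (idm X) p) v = ev p v ∘ f.
Proof.
have := tm_nat eps f (idm Y) (ptens p v).
by rewrite /= tamb_comp_mapE pmap_id /tamb_id_map comp1m.
Qed.

Lemma ev_pmapr Z X Y Y' (p : pob P Z X) (g : hom Y Y') (v : pob Q X Y) :
  ev p (pmap Q (idm X) g v) = g ∘ ev p v.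
Proof.
have := tm_nat eps (idm Z) g (ptens p v).
by rewrite /= tamb_comp_mapE pmap_id /tamb_id_map compm1.
Qed.

Lemma dual_pair_universal X Y (v : pob Q X Y) (u : pob P Y X) :
  unit_at v u -> ev u v = idm Y -> universal u.
Proof.
move=> uv evu Z p; exists (ev p v); split; first exact: unit_at_triangle.
by move=> h <-; rewrite ev_pmap evu comp1m.
Qed.

(** The Tambara structure of the Hom-profunctor sends id_X to id_(M F X), so a
Tambara morphism out of it carries eta(id_X) to eta(id_(M F X)). *)
Lemma unit_at_tstr F X Y (v : pob Q X Y) (u : pob P Y X) :
  unit_at v u -> unit_at (tstr Q F v) (tstr P F u).
Proof.
move=> uv; have := tm_str eta F (idm X : pob (tamb_id M) X X).
by rewrite uv /= tamb_comp_strE /tamb_id_str fmap_id.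
Qed.

Lemma ev_tstr F X Y (v : pob Q X Y) (u : pob P Y X) :
  ev u v = idm Y -> ev (tstr P F u) (tstr Q F v) = idm (act N F Y).
Proof.
move=> e; have := tm_str eps F (ptens u v).
by rewrite /= tamb_comp_strE /tamb_id_str e fmap_id.
Qed.

(** If eta(id_X) = v0 (x) u0, the triangle identity gives u0 = P(e,X)(u0) for
e = eps(u0 (x) v0), so e is idempotent by naturality of eps; restricting u0 and
v0 to the image of e leaves the tensor v0 (x) u0 unchanged and turns e into an
identity. *)
Lemma dual_pair_exists X : cauchy_complete N ->
  exists (Y : N) (v : pob Q X Y) (u : pob P Y X), unit_at v u /\ ev u v = idm Y.
Proof.
move=> [addN splN].
have [Y0 [v0 [u0 uv0]]] := ptens_pure (tm eta (idm X : pob (tamb_id M) X X)) addN.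
have u0E := unit_at_triangle u0 uv0.
have [Y [r [s [rs sr]]]] : exists (y : N) (r : hom Y0 y) (s : hom y Y0),
    r ∘ s = idm y /\ s ∘ r = ev u0 v0.
  by apply: splN; rewrite -ev_pmap u0E.
exists Y, (pmap Q (idm X) r v0), (pmap P s (idm X) u0); split.
- by rewrite /unit_at ptens_bal -pmap_comp comp1m sr u0E.
- by rewrite ev_pmapr ev_pmap -sr compA compA rs comp1m.
Qed.

Lemma adjoint_representable :
  cauchy_complete N -> representable (P : hom1 (CTamb C) M N).
Proof.
move=> cN; apply: representable_if_universal => X.
have [Y [v [u [uv e]]]] := dual_pair_exists X cN.
exists Y, u; split=> [|F]; first exact: dual_pair_universal uv e.
exact: dual_pair_universal (unit_at_tstr F uv) (ev_tstr F e).
Qed.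
End DualPairs.

(** * The right adjoint of a representable Tambara module *)

Section RightAdjoint.
Variables (K : fieldType) (C : moncat K) (M N : modcat C) (Phi : modfun M N).

Definition mf_strV F X : hom (Phi (act M F X)) (act N F (Phi X)) :=
  sval (cid (mf_iso Phi F X)).

Lemma mf_strVK F X : mf_strV F X ∘ mf_str Phi F X = idm _.
Proof. by rewrite /mf_strV; case: cid => g []. Qed.
Lemma mf_strKV F X : mf_str Phi F X ∘ mf_strV F X = idm _.
Proof. by rewrite /mf_strV; case: cid => g []. Qed.

Fact mf_strV_nat F (X Y : M) (f : hom X Y) :
  mf_strV F Y ∘ fmap Phi (fmap (act M F) f)
  = fmap (act N F) (fmap Phi f) ∘ mf_strV F X.
Proof.
rewrite -[LHS]compm1 -(mf_strKV F X) compA -(compA _ _ (mf_str _ _ _)) -mf_nat.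
by rewrite compA mf_strVK comp1m.
Qed.
Fact mf_strV_natl (F G : C) (h : hom F G) X :
  mf_strV G X ∘ fmap Phi (actm h X) = actm h (Phi X) ∘ mf_strV F X.
Proof.
rewrite -[LHS]compm1 -(mf_strKV F X) compA -(compA _ _ (mf_str _ _ _)) -mf_natl.
by rewrite compA mf_strVK comp1m.
Qed.
Fact mf_strV_mul G F X :
  mf_strV (tens G F) X ∘ fmap Phi (actM G F X)
  = actM G F (Phi X) ∘ (fmap (act N G) (mf_strV F X) ∘ mf_strV G (act M F X)).
Proof.
have inv : (mf_str Phi G (act M F X) ∘ fmap (act N G) (mf_str Phi F X))
    ∘ (fmap (act N G) (mf_strV F X) ∘ mf_strV G (act M F X)) = idm _.
  rewrite compA -(compA _ (fmap _ _) (fmap _ _)) -fmap_comp mf_strKV fmap_id compm1.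
  exact: mf_strKV.
rewrite -[LHS]compm1 -inv compA -(compA (mf_strV _ _)) -mf_mul.
by rewrite (compA (mf_strV _ _)) mf_strVK comp1m.
Qed.
Fact mf_strV_unit X : mf_strV mon1 X ∘ fmap Phi (act1 X) = act1 (Phi X).
Proof. by rewrite -mf_unit compA mf_strVK comp1m. Qed.

Definition corep_map (X X' : M) (Z Z' : N) (f : hom X' X) (g : hom Z Z')
    (q : hom (Phi X) Z) : hom (Phi X') Z' := g ∘ q ∘ fmap Phi f.
Definition corep_str (F : C) (X : M) (Z : N) (q : hom (Phi X) Z) :
    hom (Phi (act M F X)) (act N F Z) := fmap (act N F) q ∘ mf_strV F X.

(** The Tambara module <Phi-,->.  It uses the inverses of the structure maps of
Phi, since Phi is applied in the contravariant variable. *)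
Definition corep : tambara N M.
Proof.
refine (@Tambara K C N M (fun X Z => hom (Phi X) Z) corep_map _ _ _ _ _
  corep_str _ _ _ _ _).
- move=> X X' Z Z' f g.
  by apply: (@lin_comp _ _ _ _ (fun p => p ∘ _)); [apply: comp_linl|apply: comp_linr].
- move=> X X' Z Z' g q.
  by apply: (@lin_comp _ _ _ _ (fun p => _ ∘ p)); [apply: comp_linr|apply: fmap_lin].
- move=> X X' Z Z' f q.
  by apply: (@lin_comp _ _ _ _ (fun p => p ∘ _)); apply: comp_linl.
- by move=> X Z q; rewrite /corep_map fmap_id comp1m compm1.
- by move=> *; rewrite /corep_map fmap_comp !compA.
- move=> F X Z.
  by apply: (@lin_comp _ _ _ _ (fun p => p ∘ _)); [apply: comp_linl|apply: fmap_lin].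
- move=> F X X' Z Z' f g q; rewrite /corep_str /corep_map !fmap_comp -!compA.
  by rewrite mf_strV_nat.
- move=> F G h X Z q; rewrite /corep_map /corep_str fmap_id compm1 comp1m.
  by rewrite -compA mf_strV_natl !compA actm_nat.
- move=> G F X Z q; rewrite /corep_map /corep_str fmap_id compm1 comp1m.
  by rewrite -compA mf_strV_mul fmap_comp !compA actM_nat.
- move=> X Z q; rewrite /corep_map /corep_str -!compA mf_strV_unit -act1_nat compA.
  by case: (act1_inv Z) => -> _; rewrite comp1m.
Defined.

Variables (P : tambara M N) (x : tambmor P (P_modfun Phi))
  (y : tambmor (P_modfun Phi) P).
Hypothesis yx : forall Z X (p : pob P Z X), tm y (tm x p) = p.
Hypothesis xy : forall Z X (h : hom Z (Phi X)),
  tm x (tm y (h : pob (P_modfun Phi) Z X)) = h.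

(* The element of P corresponding to h : Z -> Phi X. *)
Local Notation yon h := (tm y (h : pob (P_modfun Phi) _ _)).

Lemma yon_pmap Z Z' X X' (f : hom Z' Z) (g : hom X X') (h : hom Z (Phi X)) :
  pmap P f g (yon h) = yon (fmap Phi g ∘ h ∘ f).
Proof. by rewrite -tm_nat. Qed.

Definition radj_unit_fun (X' X : M) (f : pob (tamb_id M) X' X) :
    pob (tamb_comp corep P) X' X :=
  ptens (idm (Phi X') : pob corep X' (Phi X')) (yon (fmap Phi (f : hom X' X))).

(** By balancing, every tensor over <Phi-,-> can be normalized to have an
identity as its left factor; equality of tensors is then tested on the right
factors. *)
Lemma ptens_corep X' X Z (q : hom (Phi X') Z) (p : pob P Z X) :
  ptens (q : pob corep X' Z) p
  = ptens (idm (Phi X') : pob corep X' (Phi X')) (pmap P q (idm X) p).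
Proof.
have e : pmap corep (idm X') q (idm (Phi X') : pob corep X' (Phi X')) = q.
  by rewrite /= /corep_map fmap_id !compm1.
by rewrite -ptens_bal e.
Qed.

Fact radj_unit_lin X' X : linear (@radj_unit_fun X' X).
Proof.
apply: (lin_comp (ptens_linr _)); apply: (lin_comp (@tm_lin _ _ _ _ _ _ y _ _)).
exact: fmap_lin.
Qed.
Fact radj_unit_nat Z Z' X X' (f : hom Z' Z) (g : hom X X') (p : pob (tamb_id M) Z X) :
  radj_unit_fun (pmap (tamb_id M) f g p)
  = pmap (tamb_comp corep P) f g (radj_unit_fun p).
Proof.
have ef : pmap corep f (idm (Phi Z)) (idm (Phi Z) : pob corep Z (Phi Z)) = fmap Phi f.
  by rewrite /= /corep_map !comp1m.
rewrite [RHS](tamb_comp_mapE f g) ef ptens_corep !yon_pmap fmap_id comp1m compm1.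
by rewrite -!fmap_comp.
Qed.
Fact radj_unit_str F Z X (p : pob (tamb_id M) Z X) :
  radj_unit_fun (tstr (tamb_id M) F p)
  = tstr (tamb_comp corep P) F (radj_unit_fun p).
Proof.
have eF : tstr corep F (idm (Phi Z) : pob corep Z (Phi Z)) = mf_strV F Z.
  by rewrite /= /corep_str fmap_id comp1m.
rewrite [RHS](tamb_comp_strE F) eF ptens_corep -tm_str yon_pmap fmap_id comp1m.
by rewrite /= /P_str mf_nat -compA mf_strKV compm1.
Qed.
Definition radj_unit : tambmor (tamb_id M) (tamb_comp corep P) :=
  TambMor radj_unit_lin radj_unit_nat radj_unit_str.

Definition radj_beta Z' Z X (p : pob P Z' X) (q : pob corep X Z) :
  pob (tamb_id N) Z' Z := (q : hom (Phi X) Z) ∘ (tm x p : hom Z' (Phi X)).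

Fact radj_bal Z' Z : pbalanced (@radj_beta Z' Z).
Proof.
split=> [X q|X p|X X' f p q].
- exact: (lin_comp (comp_linr q) (@tm_lin _ _ _ _ _ _ x Z' X)).
- exact: comp_linl.
- by rewrite /radj_beta tm_nat /= /P_map /corep_map compm1 comp1m compA.
Qed.
Fact radj_nat Z1 Z1' Z2 Z2' (f : hom Z1' Z1) (g : hom Z2 Z2') X
    (p : pob P Z1 X) (q : pob corep X Z2) :
  radj_beta (pmap P f (idm X) p) (pmap corep (idm X) g q)
  = pmap (tamb_id N) f g (radj_beta p q).
Proof.
by rewrite /radj_beta tm_nat /= /P_map /corep_map /tamb_id_map fmap_id comp1m compm1 !compA.
Qed.
Fact radj_str F Z1 Z2 X (p : pob P Z1 X) (q : pob corep X Z2) :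
  radj_beta (tstr P F p) (tstr corep F q) = tstr (tamb_id N) F (radj_beta p q).
Proof.
rewrite /radj_beta tm_str /= /P_str /corep_str /tamb_id_str fmap_comp.
by rewrite -compA (compA (mf_strV _ _)) mf_strVK comp1m.
Qed.
Definition radj_counit : tambmor (tamb_comp P corep) (tamb_id N) :=
  tlift radj_bal radj_nat radj_str.
Lemma radj_counitE Z' Z X (p : pob P Z' X) (q : hom (Phi X) Z) :
  tm radj_counit (ptens p (q : pob corep X Z)) = q ∘ (tm x p : hom Z' (Phi X)).
Proof. exact: tliftE. Qed.

Lemma corep_adjunction :
  @is_adjunction K _ (CTamb C) M N P corep radj_unit radj_counit.
Proof.
split.
- apply: (@tambmor_eq K C M N P P) => Z X p.
  transitivity (tm (tamb_lunit P) (tm (tambmor_hcomp radj_counit (tambmor_id P))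
    (tm (tamb_assocV P corep P) (tm (tambmor_hcomp (tambmor_id P) radj_unit)
      (ptens p (idm X : pob (tamb_id M) X X)))))); first by [].
  rewrite tambmor_hcompE tamb_assocVE tambmor_hcompE tamb_lunitE radj_counitE comp1m.
  by rewrite yon_pmap !fmap_id !comp1m yx.
- apply: (@tambmor_eq K C N M corep corep) => X Z q.
  transitivity (tm (tamb_runit corep) (tm (tambmor_hcomp (tambmor_id corep) radj_counit)
    (tm (tamb_assoc corep P corep) (tm (tambmor_hcomp radj_unit (tambmor_id corep))
      (ptens (idm X : pob (tamb_id M) X X) q))))); first by [].
  rewrite tambmor_hcompE tamb_assocE tambmor_hcompE radj_counitE tamb_runitE.
  by rewrite /= /corep_map !fmap_id xy !compm1.
Qed.
End RightAdjoint.

Lemma representable_adjoint (K : fieldType) (C : moncat K) (M N : modcat C)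
    (P : hom1 (CTamb C) M N) : representable P -> has_right_adjoint P.
Proof.
move=> [Phi [x [y [yx xy]]]].
exists (corep Phi : hom1 (CTamb C) N M), (radj_unit y), (radj_counit x).
apply: corep_adjunction => Z X p.
- by move/(congr1 (fun d : tambmor P P => tm d p)): yx => h; exact: h.
- move/(congr1 (fun d : tambmor (P_modfun Phi) (P_modfun Phi) => tm d p)): xy => h.
  exact: h.
Qed.

(** * Tambara morphisms between representables *)

Section FullyFaithful.
Variables (K : fieldType) (C : moncat K) (M N : modcat C) (Phi Psi : modfun M N).

Lemma P_modtrans_inj : injective (@P_modtrans K C M N Phi Psi).
Proof.
move=> d e de; apply: modtrans_eq => X.
have : tm (P_modtrans d) (idm (Phi X) : pob (P_modfun Phi) _ X)
     = tm (P_modtrans e) (idm (Phi X) : pob (P_modfun Phi) _ X) by rewrite de.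
by rewrite /= /P_trans_fun !compm1.
Qed.

Variable y : tambmor (P_modfun Phi) (P_modfun Psi).

Definition yoneda_comp X : hom (Phi X) (Psi X) :=
  tm y (idm (Phi X) : pob (P_modfun Phi) (Phi X) X).

(** The Yoneda lemma: naturality of y applied to p as a restriction of the
identity. *)
Lemma yoneda_compE Z X (p : hom Z (Phi X)) :
  tm y (p : pob (P_modfun Phi) Z X) = yoneda_comp X ∘ p.
Proof.
have := tm_nat y p (idm X) (idm (Phi X) : pob (P_modfun Phi) (Phi X) X).
by rewrite /= /P_map !fmap_id !comp1m.
Qed.

Fact yoneda_comp_nat (X X' : M) (f : hom X X') :
  yoneda_comp X' ∘ fmap Phi f = fmap Psi f ∘ yoneda_comp X.
Proof.
have := tm_nat y (idm (Phi X)) f (idm (Phi X) : pob (P_modfun Phi) (Phi X) X).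
by rewrite /= /P_map !compm1 yoneda_compE.
Qed.
Fact yoneda_comp_str F X :
  yoneda_comp (act M F X) ∘ mf_str Phi F X
  = mf_str Psi F X ∘ fmap (act N F) (yoneda_comp X).
Proof.
have := tm_str y F (idm (Phi X) : pob (P_modfun Phi) (Phi X) X).
by rewrite /= /P_str fmap_id compm1 yoneda_compE.
Qed.
Definition yoneda_trans : modtrans Phi Psi :=
  ModTrans yoneda_comp_nat yoneda_comp_str.

Lemma P_modtrans_surj : P_modtrans yoneda_trans = y.
Proof. by apply: tambmor_eq => Z X p; rewrite [RHS]yoneda_compE. Qed.
End FullyFaithful.

Theorem theorem1 (K : fieldType) (C : moncat K) :
  map_equipment (PTamb C) /\
  (forall M N : modcat C, cauchy_complete M -> cauchy_complete N ->
   forall P : hom1 (CTamb C) M N, has_right_adjoint P <-> representable P).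
Proof.
split; first split=> [//|M N Phi Psi|M N Phi].
- split=> [|y]; first exact: P_modtrans_inj.
  by exists (yoneda_trans y); apply: P_modtrans_surj.
- apply: representable_adjoint; exists Phi, (id2 (CTamb C) (ps1 (PTamb C) Phi)).
  by exists (id2 (CTamb C) (ps1 (PTamb C) Phi)); split; apply: vcomp1l.
- move=> M N _ cN P; split; last exact: representable_adjoint.
  by move=> [Q [eta [eps adj]]]; apply: adjoint_representable adj cN.
Qed.
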